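(* Let $G$ be a group acting properly and cocompactly by isometries on an asymptotically CAT(0) geodesic metric space $X$. Let $x_0\in X$ be an arbitrary point and consider the orbit $G\cdot x_0$ with the induced metric from $X$. Then, for any sufficiently large $t\in\mathbb{R}$ (i.e., there is $T\in\mathbb{R}$ such that for all $t\ge T$), the Vietoris--Rips complex $\mathcal{VR}_t(G\cdot x_0)$ is a finite $G$-CW complex and is a model for the universal space for proper actions $\underline{E}G$.
   Context: Groups are discrete. A $G$-CW complex is a CW complex with a $G$-action (permuting the open cells) such that, for all open cells $e$ and all $g\in G$, if $g\cdot e\cap e\neq\emptyset$ then $g\cdot x=x$ for all $x\in e$. It is proper if all point stabilizers are finite, and finite if it is cocompact, equivalently if it has only finitely many $G$-orbits of cells. A universal space for proper actions of $G$ is a proper $G$-CW complex $\underline{E}G$ such that, for each finite subgroup $H\le G$, the $H$-fixed point set $(\underline{E}G)^H$ is contractible. Vietoris--Rips complexes. The geometric realization $|\mathcal{P}|$ of a poset $\mathcal{P}$ is the geometric realization of its order complex, the abstract simplicial complex whose vertices are the elements of $\mathcal{P}$ and whose simplices are the finite nonempty chains. For a metric space $X_0$ with an action of $G$ by isometries, let $\mathcal{P}_{\mathrm{fn}}(X_0)$ be the poset of finite nonempty subsets of $X_0$ ordered by inclusion, with the induced $G$-action, and for $t\in\mathbb{R}$ let $\mathcal{P}_{\mathrm{fn}}^{\le t}(X_0)=\{S\in\mathcal{P}_{\mathrm{fn}}(X_0)\mid \operatorname{diam}(S)\le t\}$. Define $\mathcal{VR}_t(X_0)=|\mathcal{P}_{\mathrm{fn}}^{\le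 t}(X_0)|$, with its induced $G$-action. Asymptotically CAT(0) spaces. Let $X$ be a geodesic metric space and let $\Delta$ be a geodesic triangle in $X$ with vertices $x_1,x_2,x_3$. The comparison triangle $\overline{\Delta}$ is a geodesic triangle in $\mathbb{R}^2$ with vertices $\overline{x_1},\overline{x_2},\overline{x_3}$ such that $d(x_i,x_j)=d(\overline{x_i},\overline{x_j})$ for all $i,j\in\{1,2,3\}$. Given a point $p\in\Delta$ on the geodesic (side) from $x_i$ to $x_j$, its comparison point is the point $\overline{p}$ on the geodesic from $\overline{x_i}$ to $\overline{x_j}$ with $d(\overline{x_i},\overline{p})=d(x_i,p)$. Set $d(\Delta)=\max\{d(x_i,x_j)\mid 1\le i<j\le 3\}$. The space $X$ is asymptotically CAT(0) if there exists a function $\sigma\colon\mathbb{R}\to\mathbb{R}$ that is sublinear, i.e., $\lim_{t\to\infty}\sigma(t)/t=0$, such that for any geodesic triangle $\Delta$ in $X$ and any points $p,q\in\Delta$ we have $d(p,q)\le d(\overline{p},\overline{q})+\sigma(d(\Delta))$. An action of $G$ by isometries on a metric space $X$ is proper if for each $x\in X$ there is $r>0$ such that $\{g\in G\mid g\cdot B(x,r)\cap B(x,r)\neq\emptyset\}$ is finite; it is cocompact if there is a compact $K\subseteq X$ with $X=G\cdot K$. *)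

(* Defs.v *)
From HB Require Import structures.
From mathcomp Require Import all_boot all_order all_algebra finmap.
From mathcomp Require Import all_classical all_reals all_analysis.

Set Implicit Arguments.
Unset Strict Implicit.
Unset Printing Implicit Defensive.

Import Order.TTheory GRing.Theory Num.Theory.
Import numFieldNormedType.Exports.

Local Open Scope classical_set_scope.
Local Open Scope ring_scope.

Record gaction (G : groupType) (T : Type) := GAction {
  gact :> G -> T -> T ;
  gact1 : forall x, gact 1%g x = x ;
  gactM : forall g h x, gact (g * h)%g x = gact g (gact h x) }.

Record isom_action (R : realType) (G : groupType) (X : metricType R) :=
  IsomAction {
    isom_gaction :> gaction G X ;
    isom_mdist : forall g x y,
      mdist (isom_gaction g x) (isom_gaction g y) = mdist x y }.

Section actions.
Context {G : groupType}.

Lemma gactK (T : Type) (a : gaction G T) (g : G) :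
  cancel (a g) (a g^-1%g).
Proof. by move=> x; rewrite -gactM mulVg gact1. Qed.

Lemma gactVK (T : Type) (a : gaction G T) (g : G) :
  cancel (a g^-1%g) (a g).
Proof. by move=> x; rewrite -gactM mulgV gact1. Qed.

Definition is_subgroup (H : set G) : Prop :=
  [/\ H 1%g, forall g h, H g -> H h -> H (g * h)%g &
      forall g, H g -> H g^-1%g].

Definition stabilizer (T : Type) (a : gaction G T) (x : T) : set G :=
  [set g | a g x = x].

Definition orbit (T : Type) (a : gaction G T) (x : T) : set T :=
  [set a g x | g in [set: G]].

Definition fixed_points (T : Type) (a : gaction G T) (H : set G) : set T :=
  [set x | forall g, H g -> a g x = x].

Definition proper_action (R : realType) (X : metricType R)
    (a : isom_action G X) : Prop :=
  forall x : X, exists2 r : R, 0 < r &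
    finite_set [set g : G | a g @` ball x r `&` ball x r !=set0].

Definition cocompact (T : topologicalType) (a : gaction G T) : Prop :=
  exists2 K : set T, compact K & [set: T] = \bigcup_(g : G) (a g @` K).

End actions.

(* The library norm on ['rV_n] is the sup norm; only the (common) topology of
   ['rV_n] is taken from the library. *)

Definition enorm (R : realType) (n : nat) (v : 'rV[R]_n) : R :=
  Num.sqrt (\sum_(i < n) v ord0 i ^+ 2).

Section asymptotically_CAT0.
Context {R : realType} (X : metricType R).

Definition geodesic_path (x y : X) (c : R -> X) : Prop :=
  [/\ c 0 = x, c (mdist x y) = y &
      forall s s', s \in `[0, mdist x y] -> s' \in `[0, mdist x y] ->
        mdist (c s) (c s') = `|s - s'|].

Definition geodesic_segment (x y : X) (S : set X) : Prop :=
  exists2 c, geodesic_path x y c & S = c @` `[0, mdist x y].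

Definition geodesic_space : Prop :=
  forall x y : X, exists S, geodesic_segment x y S.

(* [side i j] is an unoriented segment, used for [i != j] only. *)
Definition geodesic_triangle (x : 'I_3 -> X) (side : 'I_3 -> 'I_3 -> set X)
    : Prop :=
  (forall i j, i != j -> geodesic_segment (x i) (x j) (side i j)) /\
  (forall i j, side i j = side j i).

Definition triangle_size (x : 'I_3 -> X) : R :=
  \big[Num.max/0]_(i < 3) \big[Num.max/0]_(j < 3 | (i < j)%N)
    mdist (x i) (x j).

Definition comparison_triangle (x : 'I_3 -> X) (xbar : 'I_3 -> 'rV[R]_2)
    : Prop :=
  forall i j, mdist (x i) (x j) = enorm (xbar i - xbar j).

Definition euclidean_segment (u v : 'rV[R]_2) : set 'rV[R]_2 :=
  [set (1 - s) *: u + s *: v | s in `[0, 1]].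

Definition comparison_point (x : 'I_3 -> X) (xbar : 'I_3 -> 'rV[R]_2)
    (i j : 'I_3) (p : X) (pbar : 'rV[R]_2) : Prop :=
  euclidean_segment (xbar i) (xbar j) pbar /\
  enorm (xbar i - pbar) = mdist (x i) p.

Definition sublinear (sigma : R -> R) : Prop :=
  sigma t / t @[t --> +oo] --> 0.

Definition asymptotically_CAT0 : Prop :=
  geodesic_space /\
  exists2 sigma : R -> R, sublinear sigma &
    forall x side xbar, geodesic_triangle x side ->
      comparison_triangle x xbar ->
    forall i j k l p q pbar qbar, i != j -> k != l ->
      side i j p -> side k l q ->
      comparison_point x xbar i j p pbar ->
      comparison_point x xbar k l q qbar ->
      mdist p q <= enorm (pbar - qbar) + sigma (triangle_size x).

End asymptotically_CAT0.

Definition homotopic (R : realType) (Y Z : topologicalType) (f g : Y -> Z)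
    : Prop :=
  exists H : R * Y -> Z,
    [/\ {within `[0, 1] `*` [set: Y], continuous H},
        forall y, H (0, y) = f y & forall y, H (1, y) = g y].

Definition contractible (R : realType) (Y : topologicalType) : Prop :=
  exists y0 : Y, @homotopic R Y Y id (fun=> y0).

(* Below, [cells n] is the collection of the open [n]-cells of [Y]. *)

Section CW.
Context (R : realType) (Y : topologicalType).

Definition closed_disc (n : nat) : set 'rV[R]_n := [set v | enorm v <= 1].
Definition open_disc (n : nat) : set 'rV[R]_n := [set v | enorm v < 1].
Definition unit_sphere (n : nat) : set 'rV[R]_n := [set v | enorm v = 1].
Arguments closed_disc n : clear implicits.
Arguments open_disc n : clear implicits.
Arguments unit_sphere n : clear implicits.

(* The third clause says that [phi] restricts to a homeomorphism from the open
   disc onto [e], the fourth one is closure finiteness. *)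
Definition characteristic_map (cells : nat -> set (set Y)) (n : nat)
    (e : set Y) (phi : 'rV[R]_n -> Y) : Prop :=
  [/\ {within closed_disc n, continuous phi},
      phi @` open_disc n = e,
      exists2 psi : Y -> 'rV[R]_n, {within e, continuous psi} &
        {in open_disc n, cancel phi psi} &
      exists2 F : set (set Y), finite_set F &
        (forall e', F e' -> exists2 m, (m < n)%N & cells m e') /\
        phi @` unit_sphere n `<=` \bigcup_(e' in F) e'].

Record CW_complex (cells : nat -> set (set Y)) : Prop := {
  CW_hausdorff : hausdorff_space Y ;
  CW_cover : forall y, exists n, exists2 e, cells n e & e y ;
  CW_disjoint : forall m n e e', cells m e -> cells n e' ->
    e `&` e' !=set0 -> m = n /\ e = e' ;
  CW_characteristic : forall n e, cells n e ->
    exists phi : 'rV[R]_n -> Y, characteristic_map cells e phi ;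
  CW_weak : forall A : set Y,
    (forall n e, cells n e -> closed (A `&` closure e)) -> closed A }.

Context (G : groupType).

Record GCW_complex (a : gaction G Y) (cells : nat -> set (set Y)) : Prop := {
  GCW_CW : CW_complex cells ;
  GCW_continuous : forall g, continuous (a g) ;
  GCW_permute : forall g n e, cells n e -> cells n (a g @` e) ;
  GCW_rigid : forall g n e, cells n e -> a g @` e `&` e !=set0 ->
    forall y, e y -> a g y = y }.

Definition proper_GCW_complex (a : gaction G Y) (cells : nat -> set (set Y))
    : Prop :=
  GCW_complex a cells /\ forall y, finite_set (stabilizer a y).

Definition finite_GCW_complex (a : gaction G Y) (cells : nat -> set (set Y))
    : Prop :=
  GCW_complex a cells /\ cocompact a.

Definition universal_proper_space (a : gaction G Y)
    (cells : nat -> set (set Y)) : Prop :=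
  proper_GCW_complex a cells /\
  forall H : set G, is_subgroup H -> finite_set H ->
    contractible R (set_type (fixed_points a H)).

End CW.

Record simplicial_complex (V : choiceType) := SimplicialComplex {
  simplex :> {fset V} -> Prop ;
  simplex_neq0 : forall s, simplex s -> s != fset0 ;
  simplex_sub : forall s s', simplex s -> (s' `<=` s)%fset -> s' != fset0 ->
    simplex s' }.

Section realization.
Context (R : realType) {V : choiceType}.

Definition is_barycentric (K : simplicial_complex V)
    (f : {fsfun V -> R with 0}) : Prop :=
  [/\ K (finsupp f), forall v, 0 <= f v & \sum_(v <- finsupp f) f v = 1].

Definition realization (K : simplicial_complex V) : Type :=
  set_type [set f | is_barycentric K f].

HB.instance Definition _ (K : simplicial_complex V) :=
  Choice.copy (realization K) (set_type [set f | is_barycentric K f]).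

Definition bary (K : simplicial_complex V) (p : realization K)
  : {fsfun V -> R with 0} := val p.

Definition closed_simplex (K : simplicial_complex V) (s : {fset V})
    : set (realization K) := [set p | (finsupp (bary p) `<=` s)%fset].

Definition open_simplex (K : simplicial_complex V) (s : {fset V})
    : set (realization K) := [set p | finsupp (bary p) = s].

(* The weak topology: [U] is open iff its trace on every closed simplex is
   open, a closed simplex being a subspace of a finite dimensional [R^s]. *)
Definition realization_open (K : simplicial_complex V)
    (U : set (realization K)) : Prop :=
  forall s, K s -> forall p, closed_simplex s p -> U p ->
    exists2 e : R, 0 < e & forall q, closed_simplex s q ->
      (forall v, `|bary p v - bary q v| < e) -> U q.

Lemma realization_openT K : realization_open [set: realization K].
Proof. by move=> s _ p _ _; exists 1. Qed.

Lemma realization_openI K : setI_closed (@realization_open K).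
Proof.
move=> A B oA oB s Ks p sp [Ap Bp].
have [e e0 eA] := oA s Ks p sp Ap; have [d d0 dB] := oB s Ks p sp Bp.
exists (Num.min e d); first by rewrite lt_min e0.
move=> q sq pq; split; [apply: eA|apply: dB] => // v.
- by have := pq v; rewrite lt_min => /andP[].
- by have := pq v; rewrite lt_min => /andP[].
Qed.

Lemma realization_open_bigU K (I : Type) (f : I -> set (realization K)) :
  (forall i, realization_open (f i)) -> realization_open (\bigcup_i f i).
Proof.
move=> of_ s Ks p sp [i _ fip]; have [e e0 ef] := of_ i s Ks p sp fip.
by exists e => // q sq pq; exists i => //; exact: ef.
Qed.

HB.instance Definition _ (K : simplicial_complex V) :=
  @isOpenTopological.Build (realization K) (@realization_open K)
    (@realization_openT K) (@realization_openI K) (@realization_open_bigU K).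

Definition simplex_cells (K : simplicial_complex V) (n : nat)
    : set (set (realization K)) :=
  [set open_simplex s | s in [set s | K s /\ #|` s| = n.+1]].

End realization.

Section realization_action.
Context (R : realType) (G : groupType) {V : choiceType}
  (K : simplicial_complex V) (a : gaction G V).
Hypothesis aK : forall g s, K s -> K (a g @` s)%fset.

Definition bary_act (g : G) (f : {fsfun V -> R with 0})
    : {fsfun V -> R with 0} :=
  [fsfun v in (a g @` finsupp f)%fset => f (a g^-1%g v)].

Lemma mem_act_fset g (s : {fset V}) v :
  (v \in (a g @` s)%fset) = (a g^-1%g v \in s).
Proof.
apply/imfsetP/idP => [[w ws ->]|vs]; first by rewrite gactK.
by exists (a g^-1%g v) => //; rewrite gactVK.
Qed.

Lemma bary_actE g f v : bary_act g f v = f (a g^-1%g v).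
Proof.
by rewrite fsfun_fun mem_act_fset; case: finsuppP.
Qed.

Lemma finsupp_bary_act g f : finsupp (bary_act g f) = (a g @` finsupp f)%fset.
Proof.
by apply/fsetP => v; rewrite mem_act_fset !mem_finsupp bary_actE.
Qed.

Lemma bary_actP g f : is_barycentric K f -> is_barycentric K (bary_act g f).
Proof.
case=> Kf f0 f1; split; first by rewrite finsupp_bary_act; exact: aK.
- by move=> v; rewrite bary_actE.
- rewrite finsupp_bary_act big_imfset /=; last first.
    by move=> v w _ _; exact: (can_inj (gactK a g)).
  by rewrite -[RHS]f1; apply: eq_bigr => v _; rewrite bary_actE gactK.
Qed.

Definition realization_act (g : G) (p : realization R K) : realization R K :=
  exist _ (bary_act g (bary p)) (mem_set (bary_actP g (set_mem (valP p)))).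

Lemma realization_act1 p : realization_act 1%g p = p.
Proof.
apply/val_inj/fsfunP => v /=.
by rewrite bary_actE invg1 gact1.
Qed.

Lemma realization_actM g h p :
  realization_act (g * h)%g p = realization_act g (realization_act h p).
Proof.
apply/val_inj/fsfunP => v /=.
by rewrite !bary_actE invgM gactM.
Qed.

Definition realization_gaction : gaction G (realization R K) :=
  GAction realization_act1 realization_actM.

End realization_action.

Section order_complex.
Context {d : Order.disp_t} (P : porderType d).

Definition is_chain (s : {fset P}) : Prop :=
  s != fset0 /\ {in s &, forall x y, (x >=< y)%O}.

Lemma is_chain_neq0 s : is_chain s -> s != fset0.
Proof. by case. Qed.

Lemma is_chain_sub s s' :
  is_chain s -> (s' `<=` s)%fset -> s' != fset0 -> is_chain s'.
Proof.
move=> [_ sc] /fsubsetP ss s0; split => // x y xs ys.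
by apply: sc; exact: ss.
Qed.

Definition order_complex : simplicial_complex P :=
  SimplicialComplex is_chain_neq0 is_chain_sub.

Lemma order_complex_act (G : groupType) (a : gaction G P) :
  (forall g, {homo a g : x y / (x <= y)%O}) ->
  forall g s, order_complex s -> order_complex (a g @` s)%fset.
Proof.
move=> am g s [s0 sc]; split.
  have /fset0Pn[x xs] := s0.
  by apply/fset0Pn; exists (a g x); exact: in_imfset.
move=> _ _ /imfsetP[x /= xs ->] /imfsetP[y /= ys ->].
by have /orP[xy|yx] := sc x y xs ys; apply/orP; [left|right]; exact: am.
Qed.

End order_complex.

Section vietoris_rips.
Context {R : realType} (X : metricType R).

Definition diam (S : {fset X}) : R :=
  sup [set r | exists x y, [/\ x \in S, y \in S & r = mdist x y]].

Definition VR_poset (t : R) : Type :=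
  set_type [set S : {fset X} | S != fset0 /\ diam S <= t].

Context (t : R).

HB.instance Definition _ := SubChoice.copy (VR_poset t)
  (set_type [set S : {fset X} | S != fset0 /\ diam S <= t]).

Definition VR_le (S S' : VR_poset t) : bool := (val S `<=` val S')%fset.

Lemma VR_le_refl : reflexive VR_le.
Proof. by move=> S; exact: fsubset_refl. Qed.

Lemma VR_le_anti : antisymmetric VR_le.
Proof. by move=> S S'; rewrite /VR_le -eqEfsubset => /eqP/val_inj. Qed.

Lemma VR_le_trans : transitive VR_le.
Proof. by move=> S2 S1 S3; exact: fsubset_trans. Qed.

HB.instance Definition _ := Order.Le_isPOrder.Build (Order.Disp tt tt)
  (VR_poset t) VR_le_refl VR_le_anti VR_le_trans.

Definition VR_simplicial : simplicial_complex (VR_poset t) :=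
  order_complex (VR_poset t).

Definition VR : topologicalType := realization R VR_simplicial.

Definition VR_cells : nat -> set (set VR) :=
  @simplex_cells R _ VR_simplicial.

Context (G : groupType) (a : isom_action G X).

Lemma diam_act g (S : {fset X}) : diam (a g @` S)%fset = diam S.
Proof.
congr sup; apply/seteqP; split => r /=.
- move=> [_ [_ [/imfsetP[x /= xS ->] /imfsetP[y /= yS ->] ->]]].
  by exists x, y; rewrite isom_mdist.
- move=> [x [y [xS yS ->]]]; exists (a g x), (a g y).
  by rewrite isom_mdist; split => //; exact: in_imfset.
Qed.

Lemma VR_poset_actP g (S : VR_poset t) :
  (a g @` val S)%fset \in [set S : {fset X} | S != fset0 /\ diam S <= t].
Proof.
have /set_mem[/fset0Pn[x xS] dS] := valP S.
apply/mem_set; split; last by rewrite diam_act.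
by apply/fset0Pn; exists (a g x); exact: in_imfset.
Qed.

Definition VR_poset_act (g : G) (S : VR_poset t) : VR_poset t :=
  exist _ (a g @` val S)%fset (VR_poset_actP g S).

Lemma VR_poset_act1 S : VR_poset_act 1%g S = S.
Proof.
apply/val_inj/fsetP => x /=.
by rewrite mem_act_fset invg1 gact1.
Qed.

Lemma VR_poset_actM g h S :
  VR_poset_act (g * h)%g S = VR_poset_act g (VR_poset_act h S).
Proof.
apply/val_inj/fsetP => x /=.
by rewrite !mem_act_fset invgM gactM.
Qed.

Definition VR_poset_gaction : gaction G (VR_poset t) :=
  GAction VR_poset_act1 VR_poset_actM.

Lemma VR_poset_act_homo g : {homo VR_poset_gaction g : S S' / (S <= S')%O}.
Proof.
move=> S S' /fsubsetP SS'; apply/fsubsetP => x /=.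
by rewrite !mem_act_fset; exact: SS'.
Qed.

Definition VR_gaction : gaction G VR :=
  realization_gaction R (order_complex_act VR_poset_act_homo).

End vietoris_rips.

Section induced_metric.
Context {R : realType} {X : metricType R} (A : set X).

Definition sub_mdist (x y : A) : R := mdist (val x) (val y).

Lemma sub_mdist_ge0 x y : 0 <= sub_mdist x y.
Proof. exact: mdist_ge0. Qed.

Lemma sub_mdist_positivity x y : sub_mdist x y = 0 -> x = y.
Proof. by move=> /mdist_positivity/val_inj. Qed.

Lemma sub_ballEmdist (x : A) (r : R) : ball x r = [set y | sub_mdist x y < r].
Proof. by rewrite /ball /= /initial_ball ballEmdist. Qed.

HB.instance Definition _ := @PseudoMetric_isMetric.Build R (set_type A)
  sub_mdist sub_mdist_ge0 sub_mdist_positivity sub_ballEmdist.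

End induced_metric.

Section orbit_action.
Context {R : realType} {G : groupType} {X : metricType R}
  (a : isom_action G X) (x0 : X).

Definition orbit_space : metricType R := set_type (orbit a x0).

Lemma orbit_actP g (x : orbit_space) : a g (val x) \in orbit a x0.
Proof.
have /set_mem[h _ <-] := valP x.
by apply/mem_set; exists (g * h)%g => //; rewrite gactM.
Qed.

Definition orbit_act (g : G) (x : orbit_space) : orbit_space :=
  exist _ (a g (val x)) (orbit_actP g x).

Lemma orbit_act1 x : orbit_act 1%g x = x.
Proof. by apply/val_inj; rewrite /= gact1. Qed.

Lemma orbit_actM g h x : orbit_act (g * h)%g x = orbit_act g (orbit_act h x).
Proof. by apply/val_inj; rewrite /= gactM. Qed.

Definition orbit_gaction : gaction G orbit_space :=
  GAction orbit_act1 orbit_actM.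

Lemma orbit_act_mdist g x y :
  mdist (orbit_gaction g x) (orbit_gaction g y) = mdist x y.
Proof. exact: isom_mdist. Qed.

Definition orbit_isom_action : isom_action G orbit_space :=
  IsomAction orbit_act_mdist.

End orbit_action.

(* Main.v *)
Require Import Defs.
From mathcomp Require Import all_boot all_order all_algebra finmap ring lra.
From mathcomp Require Import all_classical all_reals all_analysis.

Set Implicit Arguments.
Unset Strict Implicit.
Unset Printing Implicit Defensive.

Import Order.TTheory GRing.Theory Num.Theory.
Import numFieldNormedType.Exports.

Local Open Scope classical_set_scope.
Local Open Scope ring_scope.

(** Write [X0] for the orbit. The plan is to exhibit the complex at scale [t] as
    a retract, equivariantly under all isometries, of the complex at scale
    infinity, which is contracted by straight lines.

    A point of the complex is a convex combination of a chain of finite sets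
    [S]; adding up the indicator functions of these sets with the same
    coefficients gives a weight, a nonnegative function on [X0] with support of
    diameter at most [t]. The chain and its coefficients are recovered from the
    weight as its superlevel sets and the gaps between its values, called layers
    below ([layer_cake], [weightK]). So the complex is the space of such weights
    up to scaling, and any two weights can be joined by a segment if no
    condition is put on the diameter of the support.

    To come back from a scale [11/10 * r] to a scale [r], replace in a weight
    every superlevel set of diameter more than [r] by the set of its
    circumcentres in [X0], that is of all points minimising the largest distance
    to the set ([relabel], [recenter]). Two such circumcentres, of nested sets,
    are at distance at most [r] ([recenter_close]). Indeed in a CAT(0) space, if
    [c] is the centre of a set of radius [rho] then every [x] is at distance at
    least the square root of [rho^2 + d(c, x)^2] from some point of the set;
    for a set of diameter [D] this gives a radius of at most [D / sqrt 2], and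
    for nested sets it bounds the distance of the centres by the larger
    radius. Since [11/10 / sqrt 2 < 1], there is room for the errors.
    Only triangles of size comparable to [r] occur, so a sublinear error is a
    small multiple of [r] as soon as [r] is large ([quarter_point],
    [center_inequality]); this fixes the threshold for [t] once and for all,
    with no reference to a subgroup.

    Weights with support of diameter at most [r] are not changed by this
    operation, so that composing it over the scales [(11/10)^n * t] gives a
    retraction of all finitely supported weights onto those at scale [t]
    ([shrink_all]). Applied to the segment from a weight to the indicator of a
    finite set [B] it yields a contraction of the complex ([contraction_map]).
    All choices being canonical, this contraction preserves the fixed points of
    every group element that preserves [B]. Taking for [B] an orbit of a finite
    subgroup contracts its fixed point set ([VR_fixed_contractible]).

    The remaining facts are of a general nature: the open simplices of a
    realization with its weak topology form a CW structure
    ([realization_CW]); homotopies out of it may be tested on closed simplices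
    ([realization_homotopy_continuous]); and a proper cocompact action on a
    geodesic space has locally finite orbits with finite stabilizers
    ([finite_displacement]). *)

(** * Maxima over finite index sets *)

Section seq_extrema.
Context {R : realType} {I : eqType}.
Implicit Types (r : seq I) (F : I -> R) (x : R).

Lemma bigmax_attained r F x :
  \big[Num.max/x]_(i <- r) F i = x \/
  exists2 i, i \in r & \big[Num.max/x]_(i <- r) F i = F i.
Proof.
elim: r => [|j r IH]; first by rewrite big_nil; left.
rewrite big_cons; case: (leP (F j) (\big[Num.max/x]_(i <- r) F i)) => _.
  case: IH => [->|[i ir ->]]; first by left.
  by right; exists i => //; rewrite inE ir orbT.
by right; exists j => //; rewrite inE eqxx.
Qed.

Lemma bigmin_attained r F x :
  \big[Num.min/x]_(i <- r) F i = x \/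
  exists2 i, i \in r & \big[Num.min/x]_(i <- r) F i = F i.
Proof.
elim: r => [|j r IH]; first by rewrite big_nil; left.
rewrite big_cons; case: (leP (F j) (\big[Num.min/x]_(i <- r) F i)) => _.
  by right; exists j => //; rewrite inE eqxx.
case: IH => [->|[i ir ->]]; first by left.
by right; exists i => //; rewrite inE ir orbT.
Qed.

Lemma bigmin_le_seq r F x i : i \in r -> \big[Num.min/x]_(j <- r) F j <= F i.
Proof.
elim: r => // j r IH; rewrite inE big_cons ge_min => /orP[/eqP->|/IH->].
  by rewrite lexx.
by rewrite orbT.
Qed.

End seq_extrema.

Section continuity_of_maxima.
Context {R : realType} {I : Type} (F : set_system I) {FF : Filter F}.

Lemma near_fset {T : choiceType} (A : {fset T}) (P : T -> I -> Prop) :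
  (forall x, x \in A -> \forall i \near F, P x i) ->
  \forall i \near F, forall x, x \in A -> P x i.
Proof.
move=> AP; suff : forall r : seq T, {subset r <= A} ->
    \forall i \near F, forall x, x \in r -> P x i by apply.
elim=> [|y r IH] sub; first exact: nearW.
have /IH : {subset r <= A} by move=> x xr; apply: sub; rewrite inE xr orbT.
have := AP y (sub y (mem_head _ _)).
apply: filterS2 => i Py Pr x; rewrite inE => /orP[/eqP->//|]; exact: Pr.
Qed.

Lemma cvgr_max (f g : I -> R) (x y : R) :
  f i @[i --> F] --> x -> g i @[i --> F] --> y ->
  Num.max (f i) (g i) @[i --> F] --> Num.max x y.
Proof.
by move=> fx gy; apply: (continuous2_cvg _ (@max_continuous _ R (x, y)) fx gy).
Qed.

Lemma cvgr_min (f g : I -> R) (x y : R) :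
  f i @[i --> F] --> x -> g i @[i --> F] --> y ->
  Num.min (f i) (g i) @[i --> F] --> Num.min x y.
Proof.
by move=> fx gy; apply: (continuous2_cvg _ (@min_continuous _ R (x, y)) fx gy).
Qed.

Lemma cvgr_bigmax {J : Type} (r : seq J) (f : J -> I -> R) (x : J -> R) :
  (forall j, f j i @[i --> F] --> x j) ->
  \big[Num.max/0]_(j <- r) f j i @[i --> F] --> \big[Num.max/0]_(j <- r) x j.
Proof.
move=> fx; elim: r => [|j r IH].
  by rewrite big_nil; under eq_cvg do rewrite big_nil; exact: cvg_cst.
by rewrite big_cons; under eq_cvg do rewrite big_cons; exact: cvgr_max.
Qed.

Lemma cvgr_bigmin {J : Type} (r : seq J) (c : I -> R) (c0 : R)
    (f : J -> I -> R) (x : J -> R) :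
  c i @[i --> F] --> c0 -> (forall j, f j i @[i --> F] --> x j) ->
  \big[Num.min/c i]_(j <- r) f j i @[i --> F] --> \big[Num.min/c0]_(j <- r) x j.
Proof.
move=> cc fx; elim: r => [|j r IH].
  by rewrite big_nil; under eq_cvg do rewrite big_nil.
by rewrite big_cons; under eq_cvg do rewrite big_cons; exact: cvgr_min.
Qed.

Lemma cvgr_sum {J : Type} (r : seq J) (P : pred J) (f : J -> I -> R) (x : J -> R) :
  (forall j, P j -> f j i @[i --> F] --> x j) ->
  \sum_(j <- r | P j) f j i @[i --> F] --> \sum_(j <- r | P j) x j.
Proof. by move=> fx; apply: cvg_big => //; exact: add_continuous. Qed.

Lemma cvg_rV n (f : I -> 'rV[R]_n) (x : 'rV[R]_n) :
  (forall j, f i ord0 j @[i --> F] --> x ord0 j) -> f i @[i --> F] --> x.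
Proof.
move=> fx; apply/cvg_ballP => e e0.
have : \forall i \near F, forall j, j \in [fset j | j : 'I_n]%fset ->
    ball (x ord0 j) e (f i ord0 j).
  by apply: near_fset => j _; have /cvg_ballP := fx j; apply.
apply: filterS => i H; split=> // k j; rewrite ord1; apply: H.
by apply/imfsetP; exists j.
Qed.

End continuity_of_maxima.

(** * The weak topology of a geometric realization *)

Section realization_topology.
Context {R : realType} {V : choiceType} (K : simplicial_complex V).
Local Notation X := (realization R K).
Implicit Types (p q : X) (s : {fset V}).

Lemma bary_ge0 p v : 0 <= bary p v.
Proof. by have /set_mem[_ + _] := valP p; apply. Qed.

Lemma bary_simplex p : K (finsupp (bary p)).
Proof. by have /set_mem[] := valP p. Qed.

Lemma realization_openE (U : set X) : open U = realization_open U.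
Proof. by []. Qed.

Lemma bary_continuous v : continuous (fun p : X => bary p v).
Proof.
move=> p; apply/(@cvgrPdist_lt _ _ _ _ (nbhs_filter p)) => e e0.
apply: (@open_nbhs_nbhs X p [set q | `|bary p v - bary q v| < e]).
split; last by rewrite /= subrr normr0.
move=> s Ks q qs /= qe; exists (e - `|bary p v - bary q v|).
  by rewrite subr_gt0.
move=> r rs /(_ v) qr; rewrite (le_lt_trans (ler_distD (bary q v) _ _))//.
by rewrite -ltrBrDl.
Qed.

(** Near [p], an open set is controlled uniformly on the full subcomplex on
    finitely many vertices: simplices not containing the carrier of [p] stay at
    a positive distance from [p]. *)
Lemma open_finite_subcomplex (U : set X) p (A : {fset V}) : open U -> U p ->
  exists2 e : R, 0 < e & forall q, (finsupp (bary q) `<=` A)%fset ->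
    (forall v, `|bary p v - bary q v| < e) -> U q.
Proof.
move=> oU Up.
have H s : exists e : R, 0 < e /\ forall q, finsupp (bary q) = s ->
    (forall v, `|bary p v - bary q v| < e) -> U q.
  have [Ks|nKs] := pselect (K s); last first.
    by exists 1; split=> // q qs; case: nKs; rewrite -qs; exact: bary_simplex.
  have [ps|/fsubsetPn[v vp vs]] := boolP (finsupp (bary p) `<=` s)%fset.
    have [e e0 eU] := oU s Ks p ps Up; exists e; split=> // q qs; apply: eU.
    by rewrite /closed_simplex/= qs.
  exists (bary p v); split=> [|q qs /(_ v)].
    by rewrite lt_neqAle eq_sym bary_ge0 andbT -mem_finsupp.
  by rewrite (@fsfun_dflt _ _ _ (bary q)) ?qs// subr0 ger0_norm ?bary_ge0// ltxx.
have [e eP] := choice H.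
exists (\big[Num.min/1]_(s <- fpowerset A) e s).
  by elim/big_ind: _ => // [x y x0 y0|s _]; [rewrite lt_min x0|exact: (eP s).1].
move=> q qA pq; apply: (eP (finsupp (bary q))).2 => // v.
apply: (lt_le_trans (pq v)).
have : finsupp (bary q) \in fpowerset A by rewrite fpowersetE.
rewrite -[_ \in fpowerset _]/(_ \in enum_fset (fpowerset A)).
elim: (enum_fset _) => // s r IH; rewrite inE big_cons ge_min.
by case/orP => [/eqP->|/IH->]; rewrite ?lexx// orbT.
Qed.

(** The weak topology is not first countable in general, but along families that
    stay in a finite subcomplex it is the topology of coordinates. *)
Lemma cvg_realization {I : Type} (F : set_system I) {FF : Filter F}
    (f : I -> X) p (A : {fset V}) :
  (\forall i \near F, (finsupp (bary (f i)) `<=` A)%fset) ->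
  (forall v, bary (f i) v @[i --> F] --> bary p v) ->
  f i @[i --> F] --> p.
Proof.
move=> fA fp U; rewrite nbhsE => -[U' [oU' U'p] /filterS]; apply.
have [e e0 eU] := open_finite_subcomplex A oU' U'p.
have : \forall i \near F, forall v, v \in (A `|` finsupp (bary p))%fset ->
    `|bary p v - bary (f i) v| < e.
  by apply: near_fset => v _; have /cvgrPdist_lt := fp v; apply.
apply: filterS2 fA => i fiA fip; apply: eU => // v.
have [vA|] := boolP (v \in (A `|` finsupp (bary p))%fset); first exact: fip.
rewrite inE negb_or => /andP[vA vp].
rewrite !fsfun_dflt ?subr0 ?normr0//; apply: contra vA.
exact: (fsubsetP fiA).
Qed.

Lemma realization_hausdorff : hausdorff_space X.
Proof.
move=> p q pq; apply/val_inj/fsfunP => v; apply: contrapT => /eqP pqv.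
have e0 : 0 < `|bary p v - bary q v| / 2 by rewrite divr_gt0// normr_gt0 subr_eq0.
have [r [/= pr qr]] := pq _ _ 
  (@cvgr_dist_lt _ _ _ _ (nbhs_filter p) _ _ (@bary_continuous v p) _ e0)
  (@cvgr_dist_lt _ _ _ _ (nbhs_filter q) _ _ (@bary_continuous v q) _ e0).
have := ler_distD (bary r v) (bary p v) (bary q v).
by rewrite (distrC (bary r v)); lra.
Qed.

Lemma simplex_card s : K s -> exists n, #|` s| = n.+1.
Proof.
by move=> /simplex_neq0 s0; exists #|` s|.-1; rewrite prednK// cardfs_gt0.
Qed.

(** Moving a point of a closed simplex slightly towards the barycentre makes all
    its coordinates positive. *)
Lemma closed_simplex_closure s : K s ->
  closed_simplex s `<=` closure (open_simplex s : set X).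
Proof.
move=> Ks p ps U; rewrite nbhsE => -[U' [oU' U'p] sU].
have [e e0 eU] := oU' s Ks p ps U'p.
have [n sn] := simplex_card Ks.
(* the fraction of the way from [p] to the barycentre *)
pose d := Num.min 1 (e / 2).
have [d0 d1 de] : [/\ 0 < d, d <= 1 & d < e].
  rewrite /d lt_min ltr01 divr_gt0// ge_min lexx gt_min; split=> //.
  by apply/orP; right; lra.
pose f : {fsfun V -> R with 0} :=
  [fsfun v in s => (1 - d) * bary p v + d / n.+1%:R].
have fE v : v \in s -> f v = (1 - d) * bary p v + d / n.+1%:R.
  by rewrite fsfun_fun => ->.
have fpos v : v \in s -> 0 < f v.
  move=> vs; rewrite fE// ltr_wpDl ?divr_gt0 ?ltr0n// mulr_ge0 ?bary_ge0//.
  by rewrite subr_ge0.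
have fs : finsupp f = s.
  apply/fsetP => v; rewrite mem_finsupp; have [vs|vs] := boolP (v \in s).
    by rewrite gt_eqF// fpos.
  by rewrite fsfun_fun (negbTE vs) eqxx.
have sump : \sum_(v <- s) bary p v = 1.
  have /set_mem[_ _ <-] := valP p; apply/esym/big_fset_incl => // v _.
  exact: fsfun_dflt.
have fP : is_barycentric K f.
  split; first by rewrite fs.
  - move=> v; have [vs|vs] := boolP (v \in s); first exact/ltW/fpos.
    by rewrite fsfun_fun (negbTE vs).
  - rewrite fs; under eq_big_seq => v vs do rewrite fE//.
    rewrite big_split/= -mulr_sumr sump big_const_seq count_predT iter_addr_0.
    rewrite -[size _]/(#|` s|) sn -[(d / _) *+ _]mulr_natr divfK ?pnatr_eq0//.
    by rewrite mulr1 subrK.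
exists (exist _ f (mem_set fP)); split; first exact: fs.
apply: sU; apply: eU => [|v]; first by rewrite /closed_simplex/= /bary/= fs.
rewrite /bary/= -/(bary p); have [vs|vs] := boolP (v \in s); last first.
  rewrite fsfun_fun (negbTE vs) [bary p v]fsfun_dflt ?subr0 ?normr0//.
  by apply: contra vs; exact: (fsubsetP ps).
have p1 : bary p v <= 1.
  by rewrite -sump (bigD1_seq v)//= lerDl sumr_ge0// => ? _; exact: bary_ge0.
have n1 : 0 <= (n.+1%:R : R)^-1 <= 1.
  by rewrite invr_ge0 ler0n invf_le1 ?ltr0n// ler1n.
apply: le_lt_trans de; rewrite fE//; have := bary_ge0 p v.
set x := bary p v in p1 *; set y := _^-1 in n1 *; move: n1 => /andP[y0 y1] x0.
rewrite (_ : _ - _ = d * (x - y)); last by ring.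
rewrite normrM gtr0_norm//; apply: ler_piMr; first exact: ltW.
by rewrite ler_norml; apply/andP; split; lra.
Qed.

Lemma realization_weak (A : set X) :
  (forall n e, simplex_cells n e -> closed (A `&` closure e)) -> closed A.
Proof.
move=> cA; rewrite -[A]setCK; apply: open_closedC; rewrite realization_openE.
move=> s Ks p ps Ap.
have [n sn] := simplex_card Ks.
have /closed_openC oC := cA n (open_simplex s) (ex_intro2 _ _ s (conj Ks sn) erefl).
have Cp : (~` (A `&` closure (open_simplex s : set X))) p by move=> [].
have [e e0 eC] := oC s Ks p ps Cp; exists e => // q qs pq Aq.
by apply: (eC q qs pq); split=> //; exact: closed_simplex_closure.
Qed.

(** Traces on one closed simplex of the neighbourhoods of a point. *)
Definition simplex_nbhs s p : set_system X :=
  filter_from [set e : R | 0 < e]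
    (fun e => [set q | closed_simplex s q /\
                       forall v, `|bary p v - bary q v| < e]).

#[global] Instance simplex_nbhs_filter s p : Filter (simplex_nbhs s p).
Proof.
apply: filter_from_filter; first by exists 1 => /=.
move=> e d /= e0 d0; exists (Num.min e d); first by rewrite /= lt_min e0.
move=> q [qs pq]; split; split=> // v; have := pq v; rewrite lt_min.
  by case/andP.
by case/andP.
Qed.

Lemma simplex_nbhs_closed s p : simplex_nbhs s p (closed_simplex s).
Proof. by exists 1 => //= q []. Qed.

Lemma simplex_nbhs_bary s p v :
  bary q v @[q --> simplex_nbhs s p] --> bary p v.
Proof. by apply/cvgrPdist_lt => e e0; exists e => // q [_]; apply. Qed.

(** The weak topology of a product with the line can be tested on closed
    simplices, because the line is locally compact: over a compact interval a
    tube around a point of a simplex can be chosen uniformly. *)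
Lemma realization_homotopy_continuous {Z : topologicalType} (h : R * X -> Z) :
  (forall x p s, K s -> closed_simplex s p ->
    h z @[z --> filter_prod (nbhs x) (simplex_nbhs s p)] --> h (x, p)) ->
  continuous h.
Proof.
move=> hc [s0 p0] U; rewrite nbhsE => -[U' [oU' U'p] sU].
suff : nbhs (s0, p0) (h @^-1` U') by apply: filterS => z /sU.
have hs (s1 : R) q s : K s -> closed_simplex s q -> U' (h (s1, q)) ->
    filter_prod (nbhs s1) (simplex_nbhs s q) (h @^-1` U').
  by move=> Ks qs Uq; apply: (hc _ _ _ Ks qs); exact: open_nbhs_nbhs.
have [[A B] /= [/nbhs_ballP[d /= d0 dA] [e e0 eB]] AB] :=
  hs _ _ _ (bary_simplex p0) (fsubset_refl _) U'p.
(* a compact interval around [s0] on which the homotopy maps [p0] into [U'] *)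
pose J := `[s0 - d / 2, s0 + d / 2]%classic : set R.
have JU x : J x -> U' (h (x, p0)).
  rewrite /J/= in_itv/= => /andP[sl sr]; apply: (AB (x, p0)); split=> /=.
    by apply: dA; rewrite /ball/= ltr_norml; apply/andP; split; lra.
  by apply: eB; split=> [|v]; [exact: fsubset_refl|rewrite subrr normr0].
exists (J, [set q | forall x, J x -> U' (h (x, q))]) => /=; last first.
  by move=> [s q] [/= Js]; apply.
split.
  apply/nbhs_ballP; exists (d / 2); first by rewrite /= divr_gt0.
  move=> s; rewrite /ball/= ltr_norml /J/= in_itv/= => /andP[? ?].
  by apply/andP; split; lra.
apply: open_nbhs_nbhs; split; last exact: JU.
rewrite realization_openE => s Ks q qs qU.
have /compact_near_coveringP/(_ _ (simplex_nbhs s q) (fun r x => U' (h (x, r)))) :=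
  @segment_compact R (s0 - d / 2) (s0 + d / 2).
case=> [s1 Js1|r r0 rU]; first by apply: filterS (hs _ _ _ Ks qs (qU _ Js1)) => -[].
by exists r => // q' q's qq' s1; apply: (rU q').
Qed.

End realization_topology.

(** * Radial homeomorphism of the Euclidean disc with a simplex *)

Section euclidean_norm.
Context {R : realType}.

Lemma sum_sqr_ge0 n (v : 'rV[R]_n) : 0 <= \sum_(i < n) v ord0 i ^+ 2.
Proof. by apply: sumr_ge0 => i _; exact: sqr_ge0. Qed.

Lemma enorm_ge0 n (v : 'rV[R]_n) : 0 <= enorm v.
Proof. exact: sqrtr_ge0. Qed.

Lemma coord_le_enorm n (v : 'rV[R]_n) i : `|v ord0 i| <= enorm v.
Proof.
rewrite -sqrtr_sqr ler_sqrt ?sum_sqr_ge0//.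
by rewrite (bigD1 i)//= lerDl sumr_ge0// => j _; exact: sqr_ge0.
Qed.

Lemma enorm_eq0 n (v : 'rV[R]_n) : (enorm v == 0) = (v == 0).
Proof.
apply/eqP/eqP => [v0|->]; last first.
  by rewrite /enorm big1 ?sqrtr0// => i _; rewrite mxE expr0n.
apply/rowP => i; rewrite mxE; apply/eqP; rewrite -normr_eq0; apply/eqP/le_anti.
by rewrite normr_ge0 -v0 coord_le_enorm.
Qed.

Lemma enormZ n (c : R) (v : 'rV[R]_n) : enorm (c *: v) = `|c| * enorm v.
Proof.
rewrite /enorm -sqrtr_sqr -sqrtrM ?sqr_ge0// mulr_sumr; congr Num.sqrt.
by apply: eq_bigr => i _; rewrite mxE exprMn.
Qed.

Lemma enorm_continuous n : continuous (@enorm R n).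
Proof.
move=> v; apply: (@continuous_comp _ _ _ (fun v : 'rV[R]_n =>
   \sum_(i < n) v ord0 i ^+ 2) (@Num.sqrt R)); last exact: sqrt_continuous.
apply: (@cvgr_sum _ _ _ (nbhs_filter v)) => i _.
by apply: (@cvgM _ _ _ (nbhs_filter v)); exact: coord_continuous.
Qed.

Lemma closed_disc_compact n : compact (@closed_disc R n).
Proof.
case: n => [|n].
  rewrite (_ : @closed_disc R _ = [set 0]); first exact: compact_set1.
  apply/seteqP; split => [v _|v ->]; first by apply/rowP => -[].
  by rewrite /closed_disc/= (eqP (etrans (enorm_eq0 _) (eqxx _))) ler01.
apply: bounded_closed_compact.
  exists 1; split; first exact: num_real.
  move=> M M1 v v1 /=; rewrite /Num.norm/= mx_normrE; apply: bigmax_le => [|[i j] _ /=].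
    by rewrite ltW// (lt_trans ltr01).
  rewrite ord1; apply: le_trans (ltW M1); apply: le_trans v1.
  exact: coord_le_enorm.
rewrite (_ : @closed_disc R _ = (@enorm R n.+1) @^-1` [set x | x <= 1])//.
by apply: closed_comp => [v _|]; [exact: enorm_continuous|exact: closed_le].
Qed.

End euclidean_norm.

Section gauge.
Context {R : realType} (n : nat).
Implicit Types (v : 'rV[R]_n) (F : 'I_n.+1 -> R).

(** In a family of sum 0, each term is minus the sum of the others, so it is
    controlled by the most negative one. *)
Lemma zero_sum_bound F i : \sum_j F j = 0 ->
  `|F i| <= n.+1%:R * \big[Num.max/0]_j - F j.
Proof.
move=> F0; set m := \big[_/_]_j _.
have Fm j : - F j <= m by exact: le_bigmax.
have m0 : 0 <= m by exact: bigmax_ge_id.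
have -> : n.+1%:R * m = m + n%:R * m by rewrite -addn1 natrD mulrDl mul1r addrC.
have nm0 : 0 <= n%:R * m by rewrite mulr_ge0.
rewrite ler_norml; apply/andP; split; first by have := Fm i; lra.
have -> : F i = \sum_(j < n) - F (lift i j).
  by move: F0; rewrite (bigD1_ord i)//= sumrN; lra.
suff : \sum_(j < n) - F (lift i j) <= \sum_(j < n) m.
  by rewrite sumr_const card_ord -mulr_natl; lra.
by apply: ler_sum.
Qed.

Lemma zero_sum_min F : \sum_j F j = 0 ->
  exists i, F i = - \big[Num.max/0]_j - F j.
Proof.
move=> F0.
have [m0|[i _ ->]] := bigmax_attained (index_enum 'I_n.+1) (fun j => - F j) 0.
  exists ord0; apply/eqP; rewrite m0 oppr0 -normr_eq0; apply/eqP/le_anti.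
  by rewrite normr_ge0 (le_trans (zero_sum_bound _ F0))// m0 mulr0.
by exists i; rewrite opprK.
Qed.

(** The linear isomorphism of [R^n] with the vectors of [R^(n+1)] of sum 0. *)
Definition sum0_ext v (i : 'I_n.+1) : R :=
  if unlift ord_max i is Some j then v ord0 j else - \sum_j v ord0 j.

Lemma sum0_ext_lift v j : sum0_ext v (lift ord_max j) = v ord0 j.
Proof. by rewrite /sum0_ext liftK. Qed.

Lemma sum0_extE v : \sum_i sum0_ext v i = 0.
Proof.
rewrite (bigD1_ord ord_max)//= {1}/sum0_ext unlift_none.
by under eq_bigr do rewrite sum0_ext_lift; rewrite addNr.
Qed.

Lemma sum0_extK F : \sum_i F i = 0 ->
  sum0_ext (\row_j F (lift ord_max j)) =1 F.
Proof.
move=> F0 i; rewrite /sum0_ext; case: unliftP => [j ->|->]; first by rewrite mxE.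
rewrite (bigD1_ord ord_max)//= in F0; under eq_bigr do rewrite mxE.
by apply/eqP; rewrite eq_sym -subr_eq0 opprK F0.
Qed.

Lemma sum0_extZ c v i : sum0_ext (c *: v) i = c * sum0_ext v i.
Proof.
rewrite /sum0_ext; case: unlift => [j|]; first by rewrite mxE.
by under eq_bigr do rewrite mxE; rewrite -mulr_sumr mulrN.
Qed.

Lemma sum0_ext_continuous i : continuous (sum0_ext^~ i).
Proof.
move=> v; rewrite /sum0_ext; case: unlift => [j|]; first exact: coord_continuous.
apply: (@cvgN _ _ _ _ (nbhs_filter v)).
by apply: (@cvgr_sum _ _ _ (nbhs_filter v)) => j _; exact: coord_continuous.
Qed.

(** The gauge for which the unit ball is the simplex centred at the origin. *)
Definition gauge v : R := n.+1%:R * \big[Num.max/0]_i - sum0_ext v i.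

Lemma gauge_ge0 v : 0 <= gauge v.
Proof. by rewrite mulr_ge0// bigmax_ge_id. Qed.

Lemma sum0_ext_le_gauge v i : `|sum0_ext v i| <= gauge v.
Proof. exact/zero_sum_bound/sum0_extE. Qed.

Lemma gauge_eq0 v : (gauge v == 0) = (v == 0).
Proof.
apply/eqP/eqP => [v0|->].
  apply/rowP => j; rewrite mxE -sum0_ext_lift; apply/eqP.
  rewrite -normr_eq0; apply/eqP/le_anti.
  by rewrite normr_ge0 -v0 sum0_ext_le_gauge.
rewrite /gauge bigmax_eq_id ?mulr0// => i _.
by rewrite -(scale0r (0 : 'rV[R]_n)) sum0_extZ mul0r oppr0.
Qed.

Lemma gaugeZ c v : 0 <= c -> gauge (c *: v) = c * gauge v.
Proof.
move=> c0; rewrite /gauge mulrCA; congr (_ * _).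
under eq_bigr do rewrite sum0_extZ -mulrN.
elim: index_enum => [|i r IH]; first by rewrite !big_nil mulr0.
by rewrite !big_cons IH maxr_pMr.
Qed.

Lemma gauge_continuous : continuous gauge.
Proof.
move=> v; apply: (@cvgM _ _ _ (nbhs_filter v)); first exact: cvg_cst.
apply: (@cvgr_bigmax _ _ _ (nbhs_filter v)) => i.
by apply: (@cvgN _ _ _ _ (nbhs_filter v)); exact: sum0_ext_continuous.
Qed.

Lemma gauge_min v : exists i, sum0_ext v i = - (gauge v / n.+1%:R).
Proof.
have [i iE] := zero_sum_min (sum0_extE v); exists i; rewrite iE.
by rewrite /gauge mulrAC divff ?mul1r// pnatr_eq0.
Qed.

Lemma gauge_lb v i : - (gauge v / n.+1%:R) <= sum0_ext v i.
Proof.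
rewrite /gauge mulrAC divff ?mul1r ?pnatr_eq0// lerNl.
exact: (le_bigmax _ (fun i => - sum0_ext v i)).
Qed.

(** Radial rescalings exchanging the Euclidean disc and the simplex. *)
Definition to_simplex v (i : 'I_n.+1) : R :=
  n.+1%:R^-1 + enorm v / gauge v * sum0_ext v i.

Definition of_simplex v : 'rV[R]_n := (gauge v / enorm v) *: v.

Lemma enorm_gt0 v : v != 0 -> 0 < enorm v.
Proof. by move=> v0; rewrite lt_neqAle enorm_ge0 eq_sym enorm_eq0 v0. Qed.

Lemma gauge_gt0 v : v != 0 -> 0 < gauge v.
Proof. by move=> v0; rewrite lt_neqAle gauge_ge0 eq_sym gauge_eq0 v0. Qed.

Lemma rad_gauge v : enorm v / gauge v * gauge v = enorm v.
Proof.
have [->|v0] := eqVneq v 0; last by rewrite divfK// gauge_eq0.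
by rewrite (eqP (etrans (gauge_eq0 _) (eqxx _))) mulr0
  (eqP (etrans (enorm_eq0 _) (eqxx _))).
Qed.

Lemma to_simplex_sum v : \sum_i to_simplex v i = 1.
Proof.
rewrite /to_simplex big_split/= -mulr_sumr sum0_extE mulr0 addr0.
by rewrite sumr_const card_ord -[X in X = _]mulr_natr mulVf// pnatr_eq0.
Qed.

(** The smallest coordinate is an affine function of the Euclidean norm; so the
    open disc goes to the open simplex and the sphere to the boundary. *)
Lemma to_simplex_lb v i : (1 - enorm v) / n.+1%:R <= to_simplex v i.
Proof.
rewrite mulrBl mul1r /to_simplex lerD2l -{1}rad_gauge.
rewrite -[_ / _ * _ / _]mulrA -mulrN; apply: ler_wpM2l; last exact: gauge_lb.
by rewrite divr_ge0 ?enorm_ge0 ?gauge_ge0.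
Qed.

Lemma to_simplex_min v : exists i, to_simplex v i = (1 - enorm v) / n.+1%:R.
Proof.
have [i iE] := gauge_min v; exists i; rewrite /to_simplex iE.
by rewrite mulrBl mul1r -{2}(rad_gauge v) mulrN -[X in _ = _ - X]mulrA.
Qed.

Lemma to_simplexE v i :
  to_simplex v i - n.+1%:R^-1 = sum0_ext ((enorm v / gauge v) *: v) i.
Proof. by rewrite sum0_extZ addrC addKr. Qed.

Lemma of_simplexK v : of_simplex ((enorm v / gauge v) *: v) = v.
Proof.
have [->|v0] := eqVneq v 0; first by rewrite /of_simplex !scaler0.
have [e0 g0] := (enorm_gt0 v0, gauge_gt0 v0).
have c0 : 0 < enorm v / gauge v by rewrite divr_gt0.
rewrite /of_simplex gaugeZ ?ltW// enormZ gtr0_norm// scalerA -[RHS]scale1r.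
by congr (_ *: _); field; rewrite !gt_eqF.
Qed.

Lemma enorm_of_simplex v : enorm (of_simplex v) = gauge v.
Proof.
have [->|v0] := eqVneq v 0.
  rewrite /of_simplex scaler0 (eqP (etrans (gauge_eq0 _) (eqxx _))).
  by rewrite (eqP (etrans (enorm_eq0 _) (eqxx _))).
have [e0 g0] := (enorm_gt0 v0, gauge_gt0 v0).
by rewrite enormZ gtr0_norm ?divr_gt0// divfK// gt_eqF.
Qed.

Lemma to_of_simplex v i :
  to_simplex (of_simplex v) i = n.+1%:R^-1 + sum0_ext v i.
Proof.
rewrite /to_simplex enorm_of_simplex; congr (_ + _).
have [->|v0] := eqVneq v 0.
  by rewrite /of_simplex scaler0 -(scale0r (0 : 'rV[R]_n)) !sum0_extZ !mul0r mulr0.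
have [e0 g0] := (enorm_gt0 v0, gauge_gt0 v0).
rewrite /of_simplex gaugeZ ?divr_ge0 ?ltW// sum0_extZ.
by field; rewrite !gt_eqF.
Qed.

(** The radial factors are discontinuous at the origin, but bounded there by a
    continuous function vanishing at the origin once multiplied by a
    coordinate. *)
Lemma radial_continuous (f : 'rV[R]_n -> R) (c : 'rV[R]_n -> R) :
  (forall v, v != 0 -> {for v, continuous c}) -> continuous f ->
  (exists2 h : 'rV[R]_n -> R, continuous h & h 0 = 0 /\
     forall v, `|c v * f v| <= h v) ->
  continuous (fun v => c v * f v).
Proof.
move=> cc cf [h ch [h0 hle]] v; have [->|v0] := eqVneq v 0; last first.
  by apply: (@cvgM _ _ _ (nbhs_filter v)); [exact: cc|exact: cf].
have cf0 : c 0 * f 0 = 0.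
  by apply/eqP; rewrite -normr_eq0; apply/eqP/le_anti; rewrite normr_ge0 -h0 hle.
apply/(@cvgrPdist_lt _ _ _ _ (nbhs_filter _)) => e e0; rewrite cf0.
have := @cvgr_dist_lt _ _ _ _ (nbhs_filter _) _ _ (ch 0) _ e0.
apply: filterS => u; rewrite h0 !sub0r !normrN; apply: le_lt_trans.
exact: le_trans (hle u) (ler_norm _).
Qed.

Lemma to_simplex_continuous i : continuous (to_simplex^~ i).
Proof.
move=> v; apply: (@cvgD _ _ _ _ (nbhs_filter v)); first exact: cvg_cst.
apply: radial_continuous => [u u0||].
- apply: (@cvgM _ _ _ (nbhs_filter u)); first exact: enorm_continuous.
  by apply: (@cvgV _ _ _ (nbhs_filter u)); [rewrite gauge_eq0|exact: gauge_continuous].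
- exact: sum0_ext_continuous.
exists (@enorm R n); first exact: enorm_continuous.
split=> [|u]; first by rewrite (eqP (etrans (enorm_eq0 _) (eqxx _))).
rewrite normrM ger0_norm ?divr_ge0 ?enorm_ge0 ?gauge_ge0// -{2}rad_gauge.
by rewrite ler_wpM2l ?sum0_ext_le_gauge// divr_ge0 ?enorm_ge0 ?gauge_ge0.
Qed.

Lemma of_simplex_continuous : continuous of_simplex.
Proof.
move=> v; apply: (@cvg_rV _ _ _ (nbhs_filter v)) => j.
rewrite (_ : (fun i => _) = fun u => gauge u / enorm u * u ord0 j); last first.
  by apply/funext => u; rewrite mxE.
rewrite [of_simplex _ _ _]mxE.
apply: (radial_continuous (f := fun u => u ord0 j)
  (c := fun u => gauge u / enorm u)) => [u u0||].
- apply: (@cvgM _ _ _ (nbhs_filter u)); first exact: gauge_continuous.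
  by apply: (@cvgV _ _ _ (nbhs_filter u)); [rewrite enorm_eq0|exact: enorm_continuous].
- exact: coord_continuous.
exists gauge; first exact: gauge_continuous.
split=> [|u]; first by rewrite (eqP (etrans (gauge_eq0 _) (eqxx _))).
have [->|u0] := eqVneq u 0; first by rewrite mxE mulr0 normr0 gauge_ge0.
rewrite normrM ger0_norm ?divr_ge0 ?enorm_ge0 ?gauge_ge0// mulrAC -mulrA.
by rewrite ler_piMr ?gauge_ge0// ler_pdivrMr ?enorm_gt0// mul1r coord_le_enorm.
Qed.

End gauge.

(** * The cell structure of a realization *)

Section characteristic_maps.
Context {R : realType} {V : choiceType} (K : simplicial_complex V).
Local Notation X := (realization R K).
Context (s : {fset V}) (n : nat) (Ks : K s) (sn : #|` s| = n.+1).
Implicit Types (v : 'rV[R]_n) (p : X).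

Let v0 : V := xchoose (fset0Pn _ (simplex_neq0 Ks)).
Let vertex (i : 'I_n.+1) : V := nth v0 s i.
Let rank (x : V) : 'I_n.+1 := inord (index x s).

Let size_s : size (enum_fset s) = n.+1.
Proof. by rewrite -sn. Qed.

Let vertexK : cancel vertex rank.
Proof.
by move=> i; rewrite /rank /vertex index_uniq ?size_s ?fset_uniq// inord_val.
Qed.

Let rankK x : x \in s -> vertex (rank x) = x.
Proof.
move=> xs; rewrite /vertex inordK ?nth_index//.
by rewrite -size_s index_mem.
Qed.

Let vertex_in i : vertex i \in s.
Proof. by apply: mem_nth; rewrite size_s. Qed.

Let sum_vertex (F : V -> R) : \sum_(x <- s) F x = \sum_i F (vertex i).
Proof.
by rewrite (big_nth v0) big_mkord size_s.
Qed.

Definition disc_point v : {fsfun V -> R with 0} :=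
  [fsfun x in s => to_simplex v (rank x)].

Lemma disc_pointE v i : disc_point v (vertex i) = to_simplex v i.
Proof. by rewrite fsfun_fun vertex_in vertexK. Qed.

Lemma disc_point_out v x : x \notin s -> disc_point v x = 0.
Proof. by rewrite fsfun_fun => /negbTE ->. Qed.

Lemma disc_point_sub v : (finsupp (disc_point v) `<=` s)%fset.
Proof.
apply/fsubsetP => x; rewrite mem_finsupp; apply: contraR.
by move=> /disc_point_out->.
Qed.

Lemma disc_pointP v : enorm v <= 1 -> is_barycentric K (disc_point v).
Proof.
move=> v1; have sum1 : \sum_(x <- finsupp (disc_point v)) disc_point v x = 1.
  rewrite (big_fset_incl _ (disc_point_sub v)) => [|x _ /fsfun_dflt//].
  by rewrite sum_vertex; under eq_bigr do rewrite disc_pointE; exact: to_simplex_sum.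
split=> [|x|//].
  apply: simplex_sub Ks (disc_point_sub v) _.
  apply: contra_eqN sum1 => /eqP ->.
  by rewrite big_seq_fset0 eq_sym oner_eq0.
have [xs|xs] := boolP (x \in s); last by rewrite disc_point_out.
rewrite -(rankK xs) disc_pointE; apply: le_trans (to_simplex_lb v _).
by rewrite divr_ge0// subr_ge0.
Qed.

Let enorm0_le1 : enorm (0 : 'rV[R]_n) <= 1.
Proof. by rewrite (eqP (etrans (enorm_eq0 _) (eqxx _))). Qed.

Definition disc_map v : X :=
  match pselect (enorm v <= 1) with
  | left h => exist _ (disc_point v) (mem_set (disc_pointP h))
  | right _ => exist _ (disc_point 0) (mem_set (disc_pointP enorm0_le1))
  end.

Lemma disc_mapE v : enorm v <= 1 -> bary (disc_map v) = disc_point v.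
Proof. by rewrite /disc_map; case: pselect. Qed.

Lemma disc_map_sub v : (finsupp (bary (disc_map v)) `<=` s)%fset.
Proof. by rewrite /disc_map; case: pselect => h /=; exact: disc_point_sub. Qed.

Lemma disc_map_open v : enorm v < 1 -> finsupp (bary (disc_map v)) = s.
Proof.
move=> v1; apply/eqP; rewrite eqEfsubset disc_map_sub; apply/fsubsetP => x xs.
rewrite mem_finsupp disc_mapE ?ltW// -(rankK xs) disc_pointE gt_eqF//.
by apply: lt_le_trans (to_simplex_lb v _); rewrite divr_gt0// subr_gt0.
Qed.

Lemma disc_map_sphere v : enorm v = 1 ->
  (finsupp (bary (disc_map v)) `<` s)%fset.
Proof.
move=> v1; rewrite fproperE disc_map_sub; apply/fsubsetPn.
have [i iE] := to_simplex_min v; exists (vertex i); first exact: vertex_in.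
by rewrite mem_finsupp disc_mapE ?v1// disc_pointE iE v1 subrr mul0r eqxx.
Qed.

Lemma disc_map_continuous : {within @closed_disc R n, continuous disc_map}.
Proof.
apply/subspace_continuousP => v v1.
apply: (@cvg_realization _ _ _ _ _ (within_filter _ (nbhs_filter v)) _ _ s).
  by apply: nearW => u; exact: disc_map_sub.
move=> x; rewrite disc_mapE//.
have D : disc_point u x @[u --> within (@closed_disc R n) (nbhs v)] --> disc_point v x.
  apply: (@cvg_within_filter _ _ _ (nbhs v)).
  have [xs|xs] := boolP (x \in s); last first.
    rewrite disc_point_out//; under eq_cvg do rewrite disc_point_out//.
    exact: cvg_cst.
  rewrite -(rankK xs) disc_pointE; under eq_cvg do rewrite disc_pointE.
  exact: to_simplex_continuous.
apply: cvg_trans D; apply: near_eq_cvg.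
by apply: filterS (withinT _ (nbhs_filter v)) => u u1; rewrite disc_mapE.
Qed.

Definition disc_coord p : 'rV[R]_n :=
  of_simplex (\row_j (bary p (vertex (lift ord_max j)) - n.+1%:R^-1)).

Lemma disc_coord_continuous : continuous disc_coord.
Proof.
move=> p; apply: (@continuous_comp _ _ _ (fun p : X =>
   \row_j (bary p (vertex (lift ord_max j)) - n.+1%:R^-1))); last first.
  exact: of_simplex_continuous.
apply: (@cvg_rV _ _ _ (nbhs_filter p)) => j; rewrite mxE.
under eq_cvg do rewrite mxE.
apply: (@cvgB _ _ _ _ (nbhs_filter p)); last exact: cvg_cst.
exact: bary_continuous.
Qed.

Lemma disc_mapK v : enorm v <= 1 -> disc_coord (disc_map v) = v.
Proof.
move=> v1; rewrite /disc_coord -[RHS]of_simplexK; congr of_simplex.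
apply/rowP => j; rewrite mxE disc_mapE// disc_pointE to_simplexE sum0_ext_lift.
by rewrite mxE.
Qed.

Lemma disc_coordP p : finsupp (bary p) = s ->
  enorm (disc_coord p) < 1 /\ disc_map (disc_coord p) = p.
Proof.
move=> ps; pose F i := bary p (vertex i) - n.+1%:R^-1.
have F0 : \sum_i F i = 0.
  have sum1 : \sum_(x <- s) bary p x = 1 by rewrite -ps; have /set_mem[] := valP p.
  rewrite big_split/= -sum_vertex sum1 sumr_const card_ord -[X in _ + X]mulr_natr.
  by rewrite mulNr mulVf ?pnatr_eq0// subrr.
pose u : 'rV[R]_n := \row_j F (lift ord_max j).
have uE : disc_coord p = of_simplex u by [].
have uF : sum0_ext u =1 F by exact: sum0_extK.
have u1 : enorm (of_simplex u) < 1.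
  rewrite enorm_of_simplex; have [i] := gauge_min u; rewrite uF /F => iE.
  have : 0 < bary p (vertex i).
    by rewrite lt_neqAle eq_sym bary_ge0 andbT -mem_finsupp ps vertex_in.
  have n0 : 0 < n.+1%:R :> R by rewrite ltr0n.
  have -> : bary p (vertex i) = (1 - gauge u) / n.+1%:R.
    by rewrite mulrBl mul1r -iE; ring.
  by rewrite pmulr_lgt0 ?invr_gt0// subr_gt0.
rewrite uE; split=> //; apply/val_inj/fsfunP => x.
rewrite -[LHS]/(bary _ x) disc_mapE ?ltW// -[RHS]/(bary p x).
have [xs|xs] := boolP (x \in s); last by rewrite disc_point_out// fsfun_dflt// ps.
by rewrite -(rankK xs) disc_pointE to_of_simplex uF /F; ring.
Qed.

End characteristic_maps.

Section realization_CW_structure.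
Context {R : realType} {V : choiceType} (K : simplicial_complex V).
Local Notation X := (realization R K).
Implicit Types (s : {fset V}) (p : X).

Lemma simplex_characteristic n (e : set X) : simplex_cells n e ->
  exists phi : 'rV[R]_n -> X, characteristic_map (@simplex_cells R V K) e phi.
Proof.
move=> [s [Ks sn] <-]; exists (@disc_map R V K s n Ks sn); split.
- exact: disc_map_continuous.
- apply/seteqP; split=> [_ [v v1 <-]|p ps]; first exact: disc_map_open.
  by have [c1 cE] := disc_coordP Ks sn ps; exists (@disc_coord R V K s n Ks p).
- exists (@disc_coord R V K s n Ks).
    apply: continuous_subspaceT; exact: disc_coord_continuous.
  by move=> v; rewrite inE => /ltW v1; exact: disc_mapK.
pose F := [set` [fset s' in fpowerset s | (s' != fset0) && (s' != s)]%fset].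
exists [set open_simplex s' | s' in F].
  by apply: finite_image; exact: finite_fset.
split=> [_ [s' + <-]|_ [v v1 <-]].
  rewrite /F/= !inE /= fpowersetE => /and3P[s's s'0 ss'].
  have Ks' := simplex_sub Ks s's s'0.
  have [m sm] := simplex_card Ks'; exists m; last by exists s'.
  by rewrite -ltnS -sm -sn fproper_ltn_card// fproperEneq ss'.
have := disc_map_sphere Ks sn v1; rewrite fproperEneq => /andP[ne sub].
exists (open_simplex (finsupp (bary (disc_map Ks sn v)))) => //.
exists (finsupp (bary (disc_map Ks sn v))) => //.
rewrite /F/= !inE /= fpowersetE sub ne andbT/=.
exact/simplex_neq0/bary_simplex.
Qed.

Lemma realization_CW : CW_complex R (@simplex_cells R V K).
Proof.
split.
- exact: realization_hausdorff.
- move=> p; have [n pn] := simplex_card (bary_simplex p).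
  exists n; exists (open_simplex (finsupp (bary p))) => //.
  by exists (finsupp (bary p)) => //; split=> //; exact: bary_simplex.
- move=> m n _ _ [s [Ks sm] <-] [s' [Ks' sn] <-] [p [/= ps ps']].
  have E : s = s' by rewrite -ps -ps'.
  by split; [apply: succn_inj; rewrite -sm -sn E|rewrite E].
- exact: simplex_characteristic.
- exact: realization_weak.
Qed.

(** The image of a closed disc by a characteristic map is compact. *)
Lemma open_simplex_compact s : K s ->
  exists2 C : set X, compact C & open_simplex s `<=` C.
Proof.
move=> Ks; have [n sn] := simplex_card Ks.
exists (@disc_map R V K s n Ks sn @` @closed_disc R n).
  apply: continuous_compact; last exact: closed_disc_compact.
  exact: disc_map_continuous.
move=> p ps; have [c1 cE] := disc_coordP Ks sn ps.
by exists (@disc_coord R V K s n Ks p) => //; exact: ltW.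
Qed.

Context {G : groupType} (a : gaction G V).
Hypothesis aK : forall g s, K s -> K (a g @` s)%fset.
Local Notation aX := (realization_gaction R aK).

(** An automorphism permutes the closed simplices isometrically. *)
Lemma realization_act_continuous g : continuous (aX g).
Proof.
apply/continuousP => U oU; rewrite realization_openE => s Ks p ps Ugp.
have cl q : closed_simplex s q -> closed_simplex (a g @` s)%fset (aX g q).
  rewrite /closed_simplex/= /bary/= finsupp_bary_act -/(bary q) => /fsubsetP qs.
  by apply/fsubsetP => v; rewrite !mem_act_fset; exact: qs.
have [e e0 eU] := oU _ (aK g Ks) _ (cl _ ps) Ugp; exists e => // q qs pq.
by apply: eU (cl _ qs) _ => v; rewrite /bary/= !bary_actE; exact: pq.
Qed.

Lemma act_open_simplex g s :
  aX g @` open_simplex s = open_simplex (a g @` s)%fset.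
Proof.
have act h (p : X) s' : open_simplex s' p -> open_simplex (a h @` s')%fset (aX h p).
  by rewrite /open_simplex/= /bary/= finsupp_bary_act -/(bary p) => ->.
apply/seteqP; split=> [_ [p ps <-]|p ps]; first exact: act.
exists (aX g^-1%g p); last exact: gactVK.
have := act g^-1%g p _ ps; congr open_simplex.
by apply/fsetP => v; rewrite !mem_act_fset invgK gactK.
Qed.

Lemma realization_GCW :
  (forall g s, K s -> (a g @` s)%fset = s -> {in s, forall v, a g v = v}) ->
  GCW_complex R aX (@simplex_cells R V K).
Proof.
move=> rigid; split; first exact: realization_CW.
- exact: realization_act_continuous.
- move=> g n _ [s [Ks sn] <-]; rewrite act_open_simplex.
  exists (a g @` s)%fset => //; split; first exact: aK.
  by rewrite -sn; apply: card_imfset => x y /(congr1 (a g^-1%g)); rewrite !gactK.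
- move=> g n _ [s [Ks sn] <-]; rewrite act_open_simplex => -[p [/= gp ps]] q qs.
  have gs : (a g @` s)%fset = s by rewrite -gp -ps.
  apply/val_inj/fsfunP => v; rewrite bary_actE -/(bary q).
  have [vs|vs] := boolP (v \in s).
    by rewrite -{1}(rigid g s Ks gs v vs) gactK.
  by rewrite !fsfun_dflt// -/(bary q) qs// -mem_act_fset gs.
Qed.

Lemma realization_cocompact (A : {fset V}) :
  (forall s, K s -> exists g, (a g @` s `<=` A)%fset) -> cocompact aX.
Proof.
move=> AK.
have /choice[C CP] s : exists C : set X,
    compact C /\ (K s -> open_simplex s `<=` C).
  have [Ks|nKs] := pselect (K s); last by exists set0; split=> //; exact: compact0.
  by have [C cC sC] := open_simplex_compact Ks; exists C.
exists (\big[setU/set0]_(s <- fpowerset A) C s).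
  by elim/big_ind: _ => [|B B'|s _]; [exact: compact0|exact: compactU|exact: (CP s).1].
apply/seteqP; split=> // p _; have Kp := bary_simplex p.
have [g gA] := AK _ Kp; exists g^-1%g => //; exists (aX g p); last exact: gactK.
rewrite -bigcup_seq; exists (a g @` finsupp (bary p))%fset.
  by rewrite /= fpowersetE.
apply: (CP _).2; first exact: aK.
by rewrite -act_open_simplex; exists p.
Qed.

End realization_CW_structure.

(** * Finitely supported weights and their layers *)

Section weights.
Context {R : realType} {T : choiceType}.
Implicit Types (w : {fsfun T -> R with 0}) (S V : {fset T}) (x y : T).

Definition wmax w : R := \big[Num.max/0]_(x <- finsupp w) w x.

(** For nonempty [S], the length of the interval of the positive heights at
    which [S] is the superlevel set of [w]. *)
Definition layer w S : R :=
  Num.max 0 (\big[Num.min/wmax w]_(x <- S) w x -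
             \big[Num.max/0]_(x <- (finsupp w `\` S)%fset) w x).

Lemma wmax_ge w x : w x <= wmax w.
Proof.
case: finsuppP => [_|xs]; first exact: bigmax_ge_id.
exact: le_bigmax_seq.
Qed.

Lemma layer_ge0 w S : 0 <= layer w S.
Proof. by rewrite le_max lexx. Qed.

(** The support may be replaced by any larger finite set, which makes layers
    comparable for weights with different supports. *)
Lemma wmaxE w V : (finsupp w `<=` V)%fset ->
  wmax w = \big[Num.max/0]_(x <- V) w x.
Proof.
move=> sV; apply/le_anti/andP; split; apply: bigmax_le => [|x _];
  rewrite ?bigmax_ge_id ?wmax_ge//.
case: finsuppP => [_|xs]; first exact: bigmax_ge_id.
by apply: le_bigmax_seq => //; apply: (fsubsetP sV).
Qed.

Lemma layerE w V S : (finsupp w `<=` V)%fset ->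
  layer w S = Num.max 0
    (\big[Num.min/(\big[Num.max/0]_(x <- V) w x)]_(x <- S) w x -
     \big[Num.max/0]_(x <- (V `\` S)%fset) w x).
Proof.
move=> sV; rewrite /layer (wmaxE sV); congr (Num.max 0 (_ - _)).
apply/le_anti/andP; split; rewrite big_seq; apply: bigmax_le => [|x xs];
  rewrite ?bigmax_ge_id//.
  apply: le_bigmax_seq => //; move: xs; rewrite !inE => /andP[-> /=].
  exact: (fsubsetP sV).
have [xw|xw] := finsuppP w x; first by rewrite bigmax_ge_id.
apply: le_bigmax_seq => //; move: xs; rewrite !inE => /andP[-> _].
by rewrite xw.
Qed.

Lemma layer_le w S x y : 0 < layer w S -> x \in S -> y \notin S ->
  layer w S <= w x - w y.
Proof.
rewrite /layer lt_max ltxx /= => d0 xS yS; rewrite ge_max.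
suff le : \big[Num.min/wmax w]_(x <- S) w x -
    \big[Num.max/0]_(x <- (finsupp w `\` S)%fset) w x <= w x - w y.
  by rewrite le andbT; apply/ltW/(lt_le_trans d0).
apply: lerB; first exact: bigmin_le_seq.
case: finsuppP => [_|ys]; first exact: bigmax_ge_id.
by apply: le_bigmax_seq => //; rewrite !inE yS.
Qed.

Lemma layer_le_in w S x : 0 < layer w S -> x \in S -> layer w S <= w x.
Proof.
rewrite /layer lt_max ltxx /= => d0 xS; rewrite ge_max.
suff le : \big[Num.min/wmax w]_(x <- S) w x -
    \big[Num.max/0]_(x <- (finsupp w `\` S)%fset) w x <= w x.
  by rewrite le andbT; apply/ltW/(lt_le_trans d0).
rewrite lerBlDr (le_trans (bigmin_le_seq _ _ xS))// lerDl.
exact: bigmax_ge_id.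
Qed.

Lemma layer_fset0 w : layer w fset0 = 0.
Proof. by rewrite /layer big_nil fsetD0 subrr maxxx. Qed.

Lemma layer_neq0 w S : 0 < layer w S -> S != fset0.
Proof. by apply: contraTneq => ->; rewrite layer_fset0 ltxx. Qed.

Lemma layer_sub w S : 0 < layer w S -> (S `<=` finsupp w)%fset.
Proof.
move=> d0; apply/fsubsetP => x /(layer_le_in d0) dx.
by rewrite mem_finsupp; apply: contraTneq dx => ->; rewrite -ltNge.
Qed.

Lemma layer_ge w S c : S != fset0 ->
  {in S, forall x, c <= w x} ->
  (forall x y, x \in S -> y \notin S -> c <= w x - w y) ->
  c <= layer w S.
Proof.
move=> S0 cS cSS; rewrite le_max; apply/orP; right.
have [x xS ->] : exists2 x, x \in S & \big[Num.min/wmax w]_(x <- S) w x = w x.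
  have [E|//] := bigmin_attained (enum_fset S) w (wmax w).
  have /fset0Pn[x xS] := S0; exists x => //.
  apply/le_anti; rewrite bigmin_le_seq//= E; exact: wmax_ge.
have [->|[y ys ->]] := bigmax_attained (finsupp w `\` S)%fset w 0.
  by rewrite subr0 cS.
by apply: cSS => //; move: ys; rewrite !inE => /andP[].
Qed.

(** Two sets of positive layer are both superlevel sets, hence nested. *)
Lemma layer_nested w S S' : 0 < layer w S -> 0 < layer w S' ->
  (S `<=` S')%fset || (S' `<=` S)%fset.
Proof.
move=> dS dS'; apply/orP; have [|/fsubsetPn[x xS xS']] := boolP (S `<=` S')%fset.
  by left.
right; apply/fsubsetP => y yS'; apply: contraT => yS.
have := lt_le_trans dS (layer_le dS xS yS).
by have := lt_le_trans dS' (layer_le dS' yS' xS'); lra.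
Qed.

Lemma fset_argmax (A : {fset T}) (F : T -> R) : A != fset0 ->
  exists2 y, y \in A & {in A, forall z, F z <= F y}.
Proof.
move=> /fset0Pn[a aA].
have [E|[y yA E]] := bigmax_attained A F (F a).
  by exists a => // z zA; rewrite -E; exact: le_bigmax_seq.
by exists y => // z zA; rewrite -E; exact: le_bigmax_seq.
Qed.

(** Descending from the value [w x] to the next smaller value [w y], exactly one
    superlevel set containing [x] does not contain [y], and its layer is the
    difference of the two values: induct on the number of smaller values. *)
Lemma layer_cake w x : (forall y, 0 <= w y) ->
  \sum_(S <- fpowerset (finsupp w) | x \in S) layer w S = w x.
Proof.
move=> w0; set P := fpowerset _.
have supS S : S \in P -> (S `<=` finsupp w)%fset by rewrite fpowersetE.
pose n := #|` [fset y in finsupp w | w y < w x]%fset|.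
have [m nm] := ubnP n; rewrite {}/n in nm; elim: m => // m IH in x nm *.
have [wx|xw] := finsuppP w x.
  rewrite big1_seq// => S /andP[xS /supS/fsubsetP/(_ _ xS)].
  by rewrite (negbTE wx).
have wx0 : 0 < w x by rewrite lt_neqAle w0 andbT eq_sym -mem_finsupp.
(* the superlevel set lost when passing from [x] to the next smaller value *)
pose L := [fset z in finsupp w | w x <= w z]%fset.
have inL z : (z \in L) = (w x <= w z).
  rewrite !inE andbC; case: (leP (w x) (w z)) => //= xz.
  by rewrite mem_finsupp gt_eqF// (lt_le_trans wx0).
have LP : L \in P by rewrite fpowersetE; apply/fsubsetP => z; rewrite !inE => /andP[].
have L0 : L != fset0 by apply/fset0Pn; exists x; rewrite inL.
rewrite big_mkcond (bigD1_seq L) ?fset_uniq// inL lexx -big_mkcondr.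
have xSL S z : x \in S -> 0 < layer w S -> z \in L -> z \in S.
  move=> xS dS; rewrite inL => xz; apply: contraT => zS.
  by have := lt_le_trans dS (layer_le dS xS zS); lra.
pose A := [fset y in finsupp w | w y < w x]%fset.
have [A0|A0] := eqVneq A fset0.
  have LE : L = finsupp w.
    apply/fsetP => z; apply/idP/idP.
      by move: LP; rewrite fpowersetE => /fsubsetP; apply.
    move=> zw; rewrite inL leNgt; apply/negP => zx.
    by move/fsetP/(_ z): A0; rewrite !inE zw zx.
  have -> : layer w L = w x.
    apply/le_anti/andP; split.
      have [dL|dL] := ltP 0 (layer w L); last exact: le_trans dL (w0 x).
      by apply: layer_le_in => //; rewrite inL.
    apply: layer_ge => // [z|z y]; rewrite inL// => xz.
    by rewrite LE => /fsfun_dflt ->; rewrite subr0.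
  rewrite big1_seq => [|S /andP[/andP[SL xS] SP]]; first exact: addr0.
  apply/le_anti; rewrite layer_ge0 andbT leNgt; apply: contra SL => dS.
  rewrite eqEfsubset {1}LE supS//; apply/fsubsetP => z; exact: xSL.
have [y yA ymax] := fset_argmax w A0.
have [yw yx] : y \in finsupp w /\ w y < w x by move: yA; rewrite !inE => /andP.
have -> : layer w L = w x - w y.
  apply/le_anti/andP; split.
    have [dL|dL] := ltP 0 (layer w L); last by lra.
    by apply: layer_le; rewrite ?inL// leNgt yx.
  apply: layer_ge => // [z|z u]; rewrite !inL.
    by have := w0 y; lra.
  move=> xz; rewrite -ltNge => ux.
  have [_|uw] := finsuppP w u; first by have := w0 y; lra.
  by have := ymax u; rewrite !inE uw ux => /(_ isT); lra.
rewrite [RHS](_ : _ = w x - w y + w y); last by rewrite subrK.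
congr (_ + _); rewrite -(IH y); last first.
  move: nm; rewrite ltnS; apply: leq_trans; apply: fproper_ltn_card.
  rewrite fproperE; apply/andP; split.
    by apply/fsubsetP => z; rewrite !inE => /andP[-> /lt_trans->].
  by apply/fsubsetPn; exists y; rewrite // !inE ltxx andbF.
rewrite big_seq_cond [RHS]big_seq_cond.
rewrite [LHS]big_mkcond [RHS]big_mkcond; apply: eq_bigr => S _ /=.
have [SP|//] := boolP (S \in P) => /=.
have [dS|dS] := ltP 0 (layer w S); last first.
  by have -> : layer w S = 0; [apply/le_anti; rewrite dS layer_ge0|do 2 case: ifP].
suff -> : (S != L) && (x \in S) = (y \in S) by [].
apply/idP/idP => [/andP[+ xS]|yS].
  apply: contraR => yS; rewrite eqEfsubset; apply/andP; split; last first.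
    by apply/fsubsetP => z; exact: xSL.
  apply/fsubsetP => z zS; rewrite inL leNgt; apply/negP => zx.
  have := lt_le_trans dS (layer_le dS zS yS).
  have zw := fsubsetP (supS _ SP) _ zS.
  by have := ymax z; rewrite !inE zw zx => /(_ isT); lra.
apply/andP; split.
  by apply: contraTneq yS => ->; rewrite inL leNgt yx.
apply: contraT => xS.
by have := lt_le_trans dS (layer_le dS yS xS); lra.
Qed.

(** Every superlevel set contains a point where the weight is maximal. *)
Lemma sum_layer w : (forall y, 0 <= w y) ->
  \sum_(S <- fpowerset (finsupp w)) layer w S = wmax w.
Proof.
move=> w0; have [w00|wN0] := eqVneq (finsupp w) fset0.
  by rewrite /wmax w00 fpowerset0 big_seq_fset1 layer_fset0 big_nil.
have [x xw xmax] := fset_argmax w wN0.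
have -> : wmax w = w x.
  by apply/le_anti; rewrite wmax_ge andbT /wmax big_seq; exact: bigmax_le.
rewrite -[RHS]layer_cake// [RHS]big_mkcond; apply: eq_big_seq => S.
rewrite fpowersetE => /fsubsetP Sw; case: ifPn => // xS.
apply/le_anti; rewrite layer_ge0 andbT leNgt; apply/negP => dS.
have /fset0Pn[y yS] := layer_neq0 dS.
have := lt_le_trans dS (layer_le dS yS xS).
by have := xmax y (Sw _ yS); lra.
Qed.

End weights.

Section combinations.
Context {R : realType} {T : choiceType}.
Implicit Types (w : {fsfun T -> R with 0}) (S : {fset T}).

Definition comb (I : choiceType) (A : {fset I}) (c : I -> R)
    (C : I -> {fset T}) : {fsfun T -> R with 0} :=
  [fsfun x in (\bigcup_(i <- A) C i)%fset => \sum_(i <- A | x \in C i) c i].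

Lemma combE (I : choiceType) (A : {fset I}) (c : I -> R) C x :
  comb A c C x = \sum_(i <- A | x \in C i) c i.
Proof.
rewrite fsfun_fun; case: ifPn => // /bigfcupP xN.
rewrite big1_seq// => i /andP[xi iA]; case: xN.
by exists i => //; rewrite iA.
Qed.

Lemma comb_ge0 (I : choiceType) (A : {fset I}) (c : I -> R) C x :
  (forall i, 0 <= c i) -> 0 <= comb A c C x.
Proof. by move=> c0; rewrite combE sumr_ge0. Qed.

Lemma comb_supp (I : choiceType) (A : {fset I}) (c : I -> R) C x :
  (forall i, 0 <= c i) ->
  reflect (exists i, [/\ i \in A, 0 < c i & x \in C i])
    (x \in finsupp (comb A c C)).
Proof.
move=> c0; rewrite mem_finsupp combE; apply: (iffP idP) => [|[i [iA ci xi]]].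
  move=> s0; apply: contrapT => nex; move: s0.
  rewrite big1_seq ?eqxx// => i /andP[xi iA]; apply/le_anti.
  by rewrite c0 andbT leNgt; apply/negP => ci; apply: nex; exists i.
rewrite psumr_neq0//; apply/hasP; exists i => //.
by rewrite xi ci.
Qed.

Lemma eq_comb (I : choiceType) (A B : {fset I}) (c : I -> R) C :
  (A `<=` B)%fset -> (forall i, i \notin A -> c i = 0) ->
  comb A c C = comb B c C.
Proof.
move=> AB cA; apply/fsfunP => x; rewrite !combE big_mkcond [RHS]big_mkcond.
by apply: big_fset_incl => // i _ iA; rewrite cA//; case: ifP.
Qed.

(** The geometric map induced by a relabelling [C] of superlevel sets: being
    linear in the layers it is continuous, although superlevel sets jump. *)
Definition relabel C w : {fsfun T -> R with 0} :=
  comb (fpowerset (finsupp w)) (layer w) C.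

Lemma relabel_ge0 C w x : 0 <= relabel C w x.
Proof. by apply: comb_ge0 => S; exact: layer_ge0. Qed.

Lemma relabel_supp C w x : reflect (exists2 S, 0 < layer w S & x \in C S)
  (x \in finsupp (relabel C w)).
Proof.
apply: (iffP (comb_supp _ _ _ (layer_ge0 w))) => [[S [? ? ?]]|[S dS xS]].
  by exists S.
by exists S; split=> //; rewrite fpowersetE layer_sub.
Qed.

Lemma relabel_id C w : (forall x, 0 <= w x) ->
  (forall S, (S `<=` finsupp w)%fset -> S != fset0 -> C S = S) ->
  relabel C w = w.
Proof.
move=> w0 CS; apply/fsfunP => x; rewrite combE -[RHS]layer_cake//.
rewrite big_mkcond [RHS]big_mkcond; apply: eq_big_seq => S; rewrite fpowersetE.
move=> Sw; have [->|S0] := eqVneq S fset0; first by rewrite layer_fset0 !if_same.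
by rewrite CS.
Qed.

Lemma layer_exists w : (forall x, 0 <= w x) -> finsupp w != fset0 ->
  exists S, 0 < layer w S.
Proof.
move=> w0 /fset0Pn[x xw]; apply: contrapT => nex.
suff /eqP : w x = 0 by apply/negP; rewrite -mem_finsupp.
rewrite -layer_cake// big1// => S _; apply/le_anti.
by rewrite layer_ge0 andbT leNgt; apply/negP => dS; apply: nex; exists S.
Qed.

Lemma relabel_neq0 C w : (forall x, 0 <= w x) ->
  (forall S, S != fset0 -> C S != fset0) ->
  finsupp w != fset0 -> finsupp (relabel C w) != fset0.
Proof.
move=> w0 C0 /(layer_exists w0)[S dS].
have /fset0Pn[y yC] := C0 _ (layer_neq0 dS).
by apply/fset0Pn; exists y; apply/relabel_supp; exists S.
Qed.

Lemma wmax_gt0 w : (forall x, 0 <= w x) -> finsupp w != fset0 -> 0 < wmax w.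
Proof.
move=> w0 /fset0Pn[x]; rewrite mem_finsupp => xw.
by apply: lt_le_trans (wmax_ge w x); rewrite lt_neqAle eq_sym xw w0.
Qed.

(** Half of the recovery of a chain from the weight that it spans: between a
    point of [S] and one outside, the weight drops by the coefficient of [S],
    since the sets of the chain containing the latter contain [S]. The other
    half is a comparison of total masses. *)
Lemma layer_comb (c : {fset T} -> R) (A : {fset {fset T}}) S :
  (forall S, 0 <= c S) -> (forall S, S \in A -> S != fset0) ->
  {in A &, forall S S', (S `<=` S')%fset || (S' `<=` S)%fset} ->
  S \in A -> c S <= layer (comb A c id) S.
Proof.
move=> c0 A0 Achain SA; apply: layer_ge; first exact: A0.
  move=> x xS; rewrite combE big_mkcond (bigD1_seq S)//= ?fset_uniq//.
  by rewrite xS lerDl sumr_ge0// => S' _; case: ifP.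
move=> x y xS yS; rewrite !combE [in X in X - _]big_mkcond.
rewrite (bigD1_seq S)//= ?fset_uniq// xS -addrA lerDl subr_ge0.
rewrite [leLHS]big_mkcond (bigD1_seq S)//= ?fset_uniq// (negbTE yS) add0r.
rewrite big_seq_cond [leRHS]big_seq_cond; apply: ler_sum => S' /andP[S'A _].
case: ifPn => [yS'|_]; last by case: ifP.
have /orP[/fsubsetP/(_ _ xS)->//|/fsubsetP/(_ _ yS')] := Achain _ _ SA S'A.
by rewrite (negbTE yS).
Qed.

Lemma wmax_comb (I : choiceType) (c : I -> R) (A : {fset I}) C :
  (forall i, 0 <= c i) -> wmax (comb A c C) <= \sum_(i <- A) c i.
Proof.
move=> c0; apply: bigmax_le => [|x _]; first exact: sumr_ge0.
rewrite combE big_mkcond; apply: ler_sum => i _.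
by case: ifP.
Qed.

End combinations.

Section fixed_weights.
Context {R : realType} {G : groupType} {T : choiceType} (a : gaction G T).
Implicit Types (w : {fsfun T -> R with 0}) (S : {fset T}) (g : G).

Definition wfixed g w := forall x, w (a g x) = w x.

Lemma imfset_act_inj g : injective (fun S => (a g @` S)%fset).
Proof.
move=> S S' E; apply/fsetP => x.
by have /fsetP/(_ (a g x)) := E; rewrite !mem_act_fset !gactK.
Qed.

Lemma card_act g S : #|` (a g @` S)%fset| = #|` S|.
Proof. by apply: card_imfset => x y /(congr1 (a g^-1%g)); rewrite !gactK. Qed.

Lemma act_fixP g S x : (a g @` S)%fset = S -> (a g x \in S) = (x \in S).
Proof. by move=> {1}<-; rewrite mem_act_fset gactK. Qed.

(** A superlevel set of an invariant weight is mapped into itself, hence onto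
    itself as it is finite. *)
Lemma layer_fixed g w S : wfixed g w -> 0 < layer w S -> (a g @` S)%fset = S.
Proof.
move=> wg dS; apply/eqP; rewrite eqEfcard card_act leqnn andbT.
apply/fsubsetP => _ /imfsetP[x /= xS ->]; apply: contraT => gxS.
by have := lt_le_trans dS (layer_le dS xS gxS); rewrite wg subrr ltxx.
Qed.

Lemma comb_fixed (I : choiceType) g (A : {fset I}) (c : I -> R) C :
  (forall i, 0 <= c i) ->
  (forall i, i \in A -> 0 < c i -> (a g @` C i)%fset = C i) ->
  wfixed g (comb A c C).
Proof.
move=> c0 gC x; rewrite !combE big_mkcond [RHS]big_mkcond.
apply: eq_big_seq => i iA.
have [ci|ci] := ltP 0 (c i); first by rewrite (act_fixP _ (gC _ iA ci)).
have -> : c i = 0 by apply/le_anti; rewrite ci c0.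
by rewrite !if_same.
Qed.

Lemma relabel_fixed g C w :
  (forall S, C (a g @` S)%fset = (a g @` C S)%fset) ->
  wfixed g w -> wfixed g (relabel C w).
Proof.
move=> gC wg; apply: comb_fixed => [|S _ dS]; first exact: layer_ge0.
by rewrite -gC (layer_fixed wg).
Qed.

End fixed_weights.

(** * Points of a Vietoris-Rips complex as weights *)

Section spread.
Context {R : realType} {X : metricType R}.
Implicit Types (S : {fset X}) (r : R).

Definition spread_le r S : Prop := {in S &, forall x y, mdist x y <= r}.

Lemma diam_leP r S : S != fset0 -> diam S <= r <-> spread_le r S.
Proof.
move=> /fset0Pn[z zS].
pose D := [set r : R |
  exists x y : X, [/\ x \in S, y \in S & r = mdist x y]].
have supD : has_sup D.
  split; first by exists (mdist z z), z, z.
  exists (\big[Num.max/0]_(x <- S) \big[Num.max/0]_(y <- S) mdist x y).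
  move=> _ [x [y [xS yS ->]]]; apply: (@bigmax_sup_seq _ _ _ _ _ x) => //.
  exact: le_bigmax_seq.
split=> [Sr x y xS yS|Sr].
  by apply: le_trans Sr; apply: ub_le_sup; [exact: supD.2|exists x, y].
by apply: ge_sup => [|_ [x [y [xS yS ->]]]]; [exact: supD.1|exact: Sr].
Qed.

Lemma spread_le_sub r S S' : (S `<=` S')%fset -> spread_le r S' -> spread_le r S.
Proof. by move=> /fsubsetP SS' S'r x y /SS' xS /SS' yS; exact: S'r. Qed.

Lemma spread_le_trans r r' S : r <= r' -> spread_le r S -> spread_le r' S.
Proof. by move=> rr' Sr x y xS yS; apply: le_trans rr'; exact: Sr. Qed.

Context {t : R}.

Lemma VR_pointP (S : VR_poset X t) : val S != fset0 /\ spread_le t (val S).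
Proof. by have /set_mem[S0 St] := valP S; split => //; apply/diam_leP. Qed.

Lemma VR_point_exists S : S != fset0 -> spread_le t S ->
  exists S' : VR_poset X t, val S' = S.
Proof.
move=> S0 St; have SP : S \in [set S : {fset X} | S != fset0 /\ diam S <= t].
  by apply/mem_set; split => //; apply/diam_leP.
by exists (exist _ S SP).
Qed.

End spread.

Section weights_of_VR.
Context {R : realType} {X : metricType R} (t : R).
Local Notation VRP := (VR_poset X t).
Local Notation VRX := (VR X t).
Implicit Types (w : {fsfun X -> R with 0}) (p : VRX).

Definition weight p : {fsfun X -> R with 0} :=
  comb (finsupp (bary p)) (bary p) (fun S : VRP => val S).

Lemma bary_chain p : {in finsupp (bary p) &, forall S S' : VRP,
  (val S `<=` val S')%fset || (val S' `<=` val S)%fset}.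
Proof. by have /set_mem[[_ +] _ _] := valP p; apply. Qed.

Lemma bary_sum p : \sum_(S <- finsupp (bary p)) bary p S = 1.
Proof. by have /set_mem[_ _] := valP p. Qed.

Lemma bary_neq0 p : finsupp (bary p) != fset0.
Proof. by have /set_mem[[]] := valP p. Qed.

Lemma bary_gt0 p S : (S \in finsupp (bary p)) = (0 < bary p S).
Proof. by rewrite mem_finsupp lt_neqAle bary_ge0 andbT eq_sym. Qed.

Lemma weight_ge0 p x : 0 <= weight p x.
Proof. by apply: comb_ge0 => S; exact: bary_ge0. Qed.

Lemma weight_spread p : spread_le t (finsupp (weight p)).
Proof.
move=> x y /(comb_supp _ _ _ (bary_ge0 p))[S [Sp _ xS]].
move=> /(comb_supp _ _ _ (bary_ge0 p))[S' [S'p _ yS]].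
have [_ St] := VR_pointP S; have [_ S't] := VR_pointP S'.
have /orP[/fsubsetP SS|/fsubsetP SS] := bary_chain Sp S'p.
  by apply: S't => //; exact: SS.
by apply: St => //; exact: SS.
Qed.

Lemma weight_neq0 p : finsupp (weight p) != fset0.
Proof.
have /fset0Pn[S Sp] := bary_neq0 p; have [/fset0Pn[x xS] _] := VR_pointP S.
apply/fset0Pn; exists x; apply/(comb_supp _ _ _ (bary_ge0 p)).
by exists S; split; rewrite -?bary_gt0.
Qed.

Lemma finite_VR_below (V : {fset X}) :
  finite_set [set S : VRP | (val S `<=` V)%fset].
Proof.
rewrite (_ : [set S : VRP | _] = val @^-1` [set` fpowerset V]).
  by apply: finite_preimage => // S S' _ _; exact: val_inj.
by apply/seteqP; split => S /=; rewrite fpowersetE.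
Qed.

(** The inverse of [weight], up to scaling. *)
Definition layer_bary w : {fsfun VRP -> R with 0} :=
  [fsfun S in fset_set [set S : VRP | (val S `<=` finsupp w)%fset] =>
     layer w (val S) / wmax w].

Lemma layer_baryE w (S : VRP) : layer_bary w S = layer w (val S) / wmax w.
Proof.
rewrite fsfun_fun in_fset_set; last exact: finite_VR_below.
case: ifPn => // /negP Sw; suff -> : layer w (val S) = 0 by rewrite mul0r.
apply/le_anti; rewrite layer_ge0 andbT leNgt; apply/negP => /layer_sub Sw'.
by apply: Sw; apply/mem_set.
Qed.

(** Sums over the points of the complex and over all subsets of a support agree,
    because subsets of a set of small diameter have small diameter. *)
Lemma sum_finsupp_val w (F : {fset X} -> R) (A : {fset VRP}) :
  spread_le t (finsupp w) -> F fset0 = 0 ->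
  (forall S : VRP, (val S `<=` finsupp w)%fset -> F (val S) != 0 -> S \in A) ->
  (forall S : VRP, S \in A -> (val S `<=` finsupp w)%fset) ->
  \sum_(S <- A) F (val S) = \sum_(S <- fpowerset (finsupp w)) F S.
Proof.
move=> wt F0 FA Aw.
have -> : \sum_(S <- A) F (val S) =
    \sum_(S <- ((fun S : VRP => val S) @` A)%fset) F S.
  by rewrite big_imfset//= => S S' _ _; exact: val_inj.
apply: big_fset_incl => [|S].
  by apply/fsubsetP => _ /imfsetP[S /= SA ->]; rewrite fpowersetE Aw.
rewrite fpowersetE => Sw SA; apply: contraNeq SA => FS.
have S0 : S != fset0 by apply: contraNneq FS => ->; rewrite F0.
have [S' S'E] := VR_point_exists S0 (spread_le_sub Sw wt).
apply/imfsetP; exists S' => //=; apply: FA; by rewrite S'E.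
Qed.

Lemma layer_baryP w : (forall x, 0 <= w x) -> finsupp w != fset0 ->
  spread_le t (finsupp w) -> is_barycentric (VR_simplicial X t) (layer_bary w).
Proof.
move=> w0 wN0 wt; have wm := wmax_gt0 w0 wN0.
have supP (S : VRP) : (S \in finsupp (layer_bary w)) = (0 < layer w (val S)).
  by rewrite mem_finsupp layer_baryE mulf_eq0 invr_eq0 (gt_eqF wm) orbF
    lt_neqAle eq_sym layer_ge0 andbT.
split; last 2 first.
- by move=> S; rewrite layer_baryE divr_ge0 ?layer_ge0// ltW.
- under eq_bigr do rewrite layer_baryE.
  rewrite -mulr_suml (@sum_finsupp_val w) ?layer_fset0// ?sum_layer ?divff ?gt_eqF//.
    by move=> S Sw lS; rewrite supP lt_neqAle layer_ge0 eq_sym lS.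
  by move=> S; rewrite supP => /layer_sub.
split; last by move=> S S'; rewrite !supP; exact: layer_nested.
have [S dS] := layer_exists w0 wN0.
have [S' S'E] := VR_point_exists (layer_neq0 dS) (spread_le_sub (layer_sub dS) wt).
by apply/fset0Pn; exists S'; rewrite supP S'E.
Qed.

(** [p0] is the value at weights whose support is empty or too wide. *)
Definition of_weight (p0 : VRX) w : VRX :=
  if pselect (is_barycentric (VR_simplicial X t) (layer_bary w)) is left h
  then exist _ (layer_bary w) (mem_set h) else p0.

Lemma of_weightE p0 w : (forall x, 0 <= w x) -> finsupp w != fset0 ->
  spread_le t (finsupp w) -> bary (of_weight p0 w) = layer_bary w.
Proof.
move=> w0 wN0 wt; rewrite /of_weight; case: pselect => // -[].
exact: layer_baryP.
Qed.

(** Each coefficient of the chain is at most the corresponding layer by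
    [layer_comb]; the layers sum up to the maximum of the weight, which is at
    most 1, the sum of the coefficients. So all these inequalities are
    equalities. *)
Lemma weightK p0 p : of_weight p0 (weight p) = p.
Proof.
apply/val_inj; rewrite -[LHS]/(bary _) -[RHS]/(bary p).
have w0 := @weight_ge0 p; have wN0 := weight_neq0 p; have wt := @weight_spread p.
rewrite of_weightE//; apply/fsfunP => S; rewrite layer_baryE.
set w := weight p in w0 wN0 wt *.
pose A := ((fun S : VRP => val S) @` finsupp (bary p))%fset.
pose c (S : {fset X}) := if insub S is Some S' then bary p S' else 0 : R.
have cE (S1 : VRP) : c (val S1) = bary p S1 by rewrite /c valK.
have c0 S' : 0 <= c S' by rewrite /c; case: insubP => // *; exact: bary_ge0.
have wE : w = comb A c id.
  apply/fsfunP => x; rewrite !combE big_mkcond [RHS]big_mkcond.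
  rewrite big_imfset/=; last by move=> ? ? _ _; exact: val_inj.
  by apply: eq_bigr => S' _; rewrite cE.
have le (S1 : VRP) : bary p S1 <= layer w (val S1).
  have [_|Sp] := finsuppP (bary p) S1; first exact: layer_ge0.
  rewrite -cE wE; apply: layer_comb => //.
  - by move=> _ /imfsetP[S' /= _ ->]; have [] := VR_pointP S'.
  - move=> _ _ /imfsetP[S2 /= S2p ->] /imfsetP[S3 /= S3p ->].
    exact: bary_chain S2p S3p.
  - by apply/imfsetP; exists S1.
have sum_le : wmax w <= 1 by rewrite -(bary_sum p); apply: wmax_comb; exact: bary_ge0.
pose B := fset_set [set S : VRP | (val S `<=` finsupp w)%fset].
have BE S' : (S' \in B) = (val S' `<=` finsupp w)%fset.
  rewrite in_fset_set; last exact: finite_VR_below.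
  by apply/idP/idP => [/set_mem|/mem_set].
have sumB : \sum_(S <- B) layer w (val S) = wmax w.
  rewrite (@sum_finsupp_val w) ?layer_fset0 ?sum_layer// => S' => [Sw _|];
  by rewrite BE.
have pB : \sum_(S <- B) bary p S = 1.
  rewrite -[RHS](bary_sum p); apply/esym/big_fset_incl => [|S' _ /fsfun_dflt//].
  apply/fsubsetP => S'; rewrite bary_gt0 BE => /lt_le_trans/(_ (le S')).
  exact: layer_sub.
have wm1 : wmax w = 1.
  apply/le_anti; rewrite sum_le -pB -sumB/=.
  by apply: ler_sum.
rewrite wm1 divr1; apply/le_anti; rewrite le andbT leNgt; apply/negP => lt.
have SB : S \in B.
  by rewrite BE layer_sub// (le_lt_trans _ lt)// bary_ge0.
have : \sum_(S <- B) bary p S < \sum_(S <- B) layer w (val S).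
  rewrite (bigD1_seq S)//= ?fset_uniq// [ltRHS](bigD1_seq S)//= ?fset_uniq//.
  by rewrite ltr_leD// ler_sum.
by rewrite sumB pB wm1 ltxx.
Qed.

Context {G : groupType} (a : isom_action G X).

(** An isometry fixing a point fixes each set of its chain, not just the chain,
    because comparable sets of the same cardinality are equal. *)
Lemma weight_fixed g p : VR_gaction t a g p = p -> wfixed a g (weight p).
Proof.
move=> gp; apply: comb_fixed => [|S Sp _]; first exact: bary_ge0.
have gS : VR_poset_act a g S \in finsupp (bary p).
  by rewrite -gp finsupp_bary_act mem_act_fset (gactK (VR_poset_gaction t a)).
apply/eqP; have /orP[le|le] := bary_chain Sp gS.
  by rewrite eq_sym eqEfcard card_act leqnn andbT; exact: le.
by rewrite eqEfcard card_act leqnn andbT; exact: le.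
Qed.

Lemma of_weight_fixed g p0 w : (forall x, 0 <= w x) -> finsupp w != fset0 ->
  spread_le t (finsupp w) -> wfixed a g w ->
  VR_gaction t a g (of_weight p0 w) = of_weight p0 w.
Proof.
move=> w0 wN0 wt wg; apply/val_inj/fsfunP => S.
rewrite -[RHS]/(bary (of_weight _ _) S) bary_actE of_weightE// !layer_baryE.
congr (_ / _) => /=.
have E S' : 0 < layer w S' -> (a g @` S')%fset = S' by exact: layer_fixed.
have K (S' : {fset X}) : (a g @` (a g^-1%g @` S'))%fset = S'.
  by apply/fsetP => x; rewrite !mem_act_fset invgK gactVK.
set S1 := (a g^-1%g @` _)%fset.
have [d1|d1] := ltP 0 (layer w S1); first by rewrite -[in RHS](K (val S)) E.
have [d2|d2] := ltP 0 (layer w (val S)); last first.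
  by apply: le_anti; rewrite (le_trans d1) ?layer_ge0// (le_trans d2) ?layer_ge0.
congr layer; apply: (imfset_act_inj (a := a) (g := g)).
by rewrite K E.
Qed.

End weights_of_VR.

(** * Contraction of a Vietoris-Rips complex *)

Section convergence_of_weights.
Context {R : realType} {I : Type} (F : set_system I) {FF : Filter F}.

(** The convergence that finite subcomplexes see; the bound on the supports makes
    the maxima and sums below range over a fixed finite set. *)
Definition wcvg {T : choiceType} (w : I -> {fsfun T -> R with 0})
    (w0 : {fsfun T -> R with 0}) : Prop :=
  exists2 V : {fset T}, (finsupp w0 `<=` V)%fset /\
      (\forall i \near F, (finsupp (w i) `<=` V)%fset) &
    forall x, w i x @[i --> F] --> w0 x.

Context {T : choiceType}.
Local Notation W := {fsfun T -> R with 0}.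

Lemma wcvg_wmax (w : I -> W) (w0 : W) : wcvg w w0 -> wmax (w i) @[i --> F] --> wmax w0.
Proof.
move=> [V [w0V wV] ww]; rewrite (wmaxE w0V).
have : \big[Num.max/0]_(x <- V) w i x @[i --> F] --> \big[Num.max/0]_(x <- V) w0 x.
  by apply: cvgr_bigmax.
apply: cvg_trans; apply: near_eq_cvg.
by apply: filterS wV => i wiV; rewrite (wmaxE wiV).
Qed.

Lemma wcvg_layer (w : I -> W) (w0 : W) S :
  wcvg w w0 -> layer (w i) S @[i --> F] --> layer w0 S.
Proof.
move=> [V [w0V wV] ww]; rewrite (layerE _ w0V).
have : Num.max 0
    (\big[Num.min/(\big[Num.max/0]_(x <- V) w i x)]_(x <- S) w i x -
     \big[Num.max/0]_(x <- (V `\` S)%fset) w i x) @[i --> F] --> Num.max 0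
    (\big[Num.min/(\big[Num.max/0]_(x <- V) w0 x)]_(x <- S) w0 x -
     \big[Num.max/0]_(x <- (V `\` S)%fset) w0 x).
  apply: cvgr_max; first exact: cvg_cst.
  apply: cvgB; last by apply: cvgr_bigmax.
  by apply: cvgr_bigmin => //; exact: cvgr_bigmax.
apply: cvg_trans; apply: near_eq_cvg.
by apply: filterS wV => i wiV; rewrite (layerE _ wiV).
Qed.

Lemma wcvg_comb (J : choiceType) (c : I -> {fsfun J -> R with 0})
    (c0 : {fsfun J -> R with 0}) (C : J -> {fset T}) :
  (forall i j, 0 <= c i j) -> (forall j, 0 <= c0 j) ->
  wcvg c c0 -> wcvg (fun i => comb (finsupp (c i)) (c i) C)
    (comb (finsupp c0) c0 C).
Proof.
move=> cp c0p [A [c0A cA] cc].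
have sub (d : {fsfun J -> R with 0}) : (forall j, 0 <= d j) -> (finsupp d `<=` A)%fset ->
    (finsupp (comb (finsupp d) d C) `<=` \bigcup_(j <- A) C j)%fset.
  move=> dp dA; apply/fsubsetP => x /(comb_supp _ _ _ dp)[j [jd _ xj]].
  by apply/bigfcupP; exists j => //; rewrite (fsubsetP dA).
exists (\bigcup_(j <- A) C j)%fset.
  by split; [exact: sub|apply: filterS cA => i ciA; exact: sub].
move=> x; rewrite (eq_comb _ c0A (fun j => @fsfun_dflt _ _ _ c0 j)) combE.
have : \sum_(j <- A | x \in C j) c i j @[i --> F] -->
    \sum_(j <- A | x \in C j) c0 j by apply: cvgr_sum.
apply: cvg_trans; apply: near_eq_cvg; apply: filterS cA => i ciA.
by rewrite (eq_comb _ ciA (fun j => @fsfun_dflt _ _ _ (c i) j)) combE.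
Qed.

Lemma wcvg_relabel C (w : I -> W) (w0 : W) : wcvg w w0 ->
  wcvg (fun i => relabel C (w i)) (relabel C w0).
Proof.
move=> ww; have [V [w0V wV] _] := ww.
have sub (u : {fsfun T -> R with 0}) : (finsupp u `<=` V)%fset ->
    (finsupp (relabel C u) `<=` \bigcup_(S <- fpowerset V) C S)%fset.
  move=> uV; apply/fsubsetP => x /relabel_supp[S dS xS].
  apply/bigfcupP; exists S => //; rewrite fpowersetE andbT.
  exact: fsubset_trans (layer_sub dS) uV.
have relE (u : {fsfun T -> R with 0}) x : (finsupp u `<=` V)%fset ->
    relabel C u x = \sum_(S <- fpowerset V | x \in C S) layer u S.
  move=> uV; rewrite -combE; congr (fun_of_fsfun _ x).
  apply: eq_comb; first by rewrite fpowersetS.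
  move=> S; rewrite fpowersetE => Su; apply/le_anti; rewrite layer_ge0 andbT.
  by rewrite leNgt; apply: contra Su; exact: layer_sub.
exists (\bigcup_(S <- fpowerset V) C S)%fset.
  by split; [exact: sub|apply: filterS wV => i wiV; exact: sub].
move=> x; rewrite relE//.
have : \sum_(S <- fpowerset V | x \in C S) layer (w i) S @[i --> F] -->
    \sum_(S <- fpowerset V | x \in C S) layer w0 S.
  by apply: cvgr_sum => S _; exact: wcvg_layer.
by apply: cvg_trans; apply: near_eq_cvg; apply: filterS wV => i wiV; rewrite relE.
Qed.

(** The segment from a weight to the indicator of [B]; [s] is clamped to the
    unit interval so that the path is defined for all real times. *)
Definition clamp (s : R) : R := Num.max 0 (Num.min 1 s).

Definition wseg (B : {fset T}) (s : R) (w0 : W) : {fsfun T -> R with 0} :=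
  [fsfun x in (finsupp w0 `|` B)%fset =>
     (1 - clamp s) * w0 x + clamp s * (x \in B)%:R].

Lemma clamp_itv s : 0 <= clamp s <= 1.
Proof. by rewrite /clamp le_max lexx/= ge_max ler01/= ge_min lexx. Qed.

Lemma wsegE B s (w0 : W) x :
  wseg B s w0 x = (1 - clamp s) * w0 x + clamp s * (x \in B)%:R.
Proof.
rewrite fsfun_fun !inE; case: ifPn => //; rewrite negb_or => /andP[xw xB].
by rewrite fsfun_dflt// (negbTE xB) !mulr0 addr0.
Qed.

Lemma wseg_supp B s (w0 : W) : (finsupp (wseg B s w0) `<=` finsupp w0 `|` B)%fset.
Proof. exact: finsupp_sub. Qed.

Lemma wseg_ge0 B s (w0 : W) x : (forall x, 0 <= w0 x) -> 0 <= wseg B s w0 x.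
Proof.
move=> wp; have /andP[c0 c1] := clamp_itv s.
by rewrite wsegE addr_ge0// mulr_ge0// subr_ge0.
Qed.

Lemma wseg_neq0 B s (w0 : W) : (forall x, 0 <= w0 x) -> finsupp w0 != fset0 ->
  B != fset0 -> finsupp (wseg B s w0) != fset0.
Proof.
move=> wp /fset0Pn[x xw] /fset0Pn[b bB]; have /andP[c0 c1] := clamp_itv s.
have wx : 0 < w0 x by rewrite lt_neqAle wp andbT eq_sym -mem_finsupp.
have [c1'|c1'] := ltP (clamp s) 1.
  apply/fset0Pn; exists x; rewrite mem_finsupp wsegE gt_eqF// ltr_wpDr//.
    by rewrite mulr_ge0.
  by rewrite mulr_gt0// subr_gt0.
apply/fset0Pn; exists b; rewrite mem_finsupp wsegE bB gt_eqF//.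
by rewrite ltr_wpDl// ?mulr_ge0 ?subr_ge0// mulr1 (lt_le_trans ltr01).
Qed.

Lemma wseg0 B (w0 : W) : wseg B 0 w0 = w0.
Proof.
apply/fsfunP => x; rewrite wsegE (_ : clamp 0 = 0) ?mul0r ?subr0 ?mul1r ?addr0//.
by rewrite /clamp (min_r ler01) maxxx.
Qed.

Lemma wseg1 B (w0 w1 : W) : wseg B 1 w0 = wseg B 1 w1.
Proof.
have c1 : clamp 1 = 1 by rewrite /clamp minxx max_r.
by apply/fsfunP => x; rewrite !wsegE c1 subrr !mul0r.
Qed.

Lemma wcvg_wseg B (w : I -> W) (w0 : W) (s : I -> R) (s0 : R) : s i @[i --> F] --> s0 ->
  wcvg w w0 -> wcvg (fun i => wseg B (s i) (w i)) (wseg B s0 w0).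
Proof.
move=> ss [V [w0V wV] ww]; exists (V `|` B)%fset.
  split; first exact: fsubset_trans (wseg_supp _ _ _) (fsetSU _ w0V).
  by apply: filterS wV => i wiV; exact: fsubset_trans (wseg_supp _ _ _) (fsetSU _ wiV).
move=> x; rewrite wsegE; under eq_cvg do rewrite wsegE.
have cc : clamp (s i) @[i --> F] --> clamp s0.
  by apply: cvgr_max; [exact: cvg_cst|apply: cvgr_min => //; exact: cvg_cst].
apply: cvgD; apply: cvgM => //; last exact: cvg_cst.
by apply: cvgB => //; exact: cvg_cst.
Qed.

End convergence_of_weights.

Section fixed_segment.
Context {R : realType} {G : groupType} {T : choiceType} (a : gaction G T).

Lemma wseg_fixed (B : {fset T}) s (w : {fsfun T -> R with 0}) g :
  (a g @` B)%fset = B -> wfixed a g w -> wfixed a g (wseg B s w).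
Proof. by move=> gB wg x; rewrite !wsegE wg (act_fixP x gB). Qed.

End fixed_segment.

Section contraction.
Context {R : realType} {X : metricType R} (t : R).
Local Notation VRX := (VR X t).
(** [C n] is thought of as pushing sets of diameter at most [r n.+1] down to
    diameter at most [r n], compatibly for nested sets. *)
Context (r : nat -> R) (C : nat -> {fset X} -> {fset X}).
Hypothesis r0 : r 0%N = t.
Hypothesis r_homo : forall n, r n <= r n.+1.
Hypothesis r_unbounded : forall S : {fset X}, exists n, spread_le (r n) S.
Hypothesis C_id : forall n S, spread_le (r n) S -> C n S = S.
Hypothesis C_neq0 : forall n (S : {fset X}), S != fset0 -> C n S != fset0.
Hypothesis C_close : forall n S S' x y, (S `<=` S')%fset ->
  spread_le (r n.+1) S' -> x \in C n S -> y \in C n S' -> mdist x y <= r n.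

Implicit Types (w : {fsfun X -> R with 0}).

Fixpoint shrink n w := if n is m.+1 then shrink m (relabel (C m) w) else w.

Lemma r_le m n : (m <= n)%N -> r m <= r n.
Proof.
elim: n => [|n IH]; first by rewrite leqn0 => /eqP ->.
by rewrite leq_eqVlt => /orP[/eqP->//|/IH/le_trans]; apply.
Qed.

(** The superlevel sets being nested, it suffices to compare the labels of two
    nested sets. *)
Lemma relabel_spread n w : spread_le (r n.+1) (finsupp w) ->
  spread_le (r n) (finsupp (relabel (C n) w)).
Proof.
move=> wr x y /relabel_supp[S dS xS] /relabel_supp[S' dS' yS'].
have sp S1 : 0 < layer w S1 -> spread_le (r n.+1) S1.
  by move=> /layer_sub/spread_le_sub; apply.
have /orP[SS'|S'S] := layer_nested dS dS'.
  by apply: C_close SS' (sp _ dS') xS yS'.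
by rewrite metric_sym; apply: C_close S'S (sp _ dS) yS' xS.
Qed.

Lemma shrinkP n w : (forall x, 0 <= w x) -> finsupp w != fset0 ->
  spread_le (r n) (finsupp w) ->
  [/\ forall x, 0 <= shrink n w x, finsupp (shrink n w) != fset0 &
      spread_le t (finsupp (shrink n w))].
Proof.
elim: n w => [|n IH] w w0 wN0 wr; first by rewrite -r0.
apply: IH; [exact: relabel_ge0| |exact: relabel_spread].
by apply: relabel_neq0 => // S; exact: C_neq0.
Qed.

Lemma shrink_id m n w : (n <= m)%N -> (forall x, 0 <= w x) ->
  spread_le (r n) (finsupp w) -> shrink m w = shrink n w.
Proof.
move=> + w0 wr; elim: m => [|m IH]; first by rewrite leqn0 => /eqP ->.
rewrite leq_eqVlt => /orP[/eqP->//|]; rewrite ltnS => nm /=.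
rewrite relabel_id ?IH// => S Sw _; apply: C_id.
by apply: spread_le_trans (r_le nm) _; exact: spread_le_sub Sw wr.
Qed.

(** The stages above the size of the support act as the identity, so any
    sufficiently large number of stages gives the same result. *)
Definition shrink_all w := shrink (xget 0%N [set n | spread_le (r n) (finsupp w)]) w.

Lemma shrink_allE n w : (forall x, 0 <= w x) -> spread_le (r n) (finsupp w) ->
  shrink_all w = shrink n w.
Proof.
move=> w0 wr; rewrite /shrink_all; case: xgetP => [m _ wm|/(_ n)//].
have [mn|/ltnW nm] := leqP m n; first by rewrite (shrink_id mn).
by rewrite (shrink_id nm).
Qed.

Lemma shrink_allP w : (forall x, 0 <= w x) -> finsupp w != fset0 ->
  [/\ forall x, 0 <= shrink_all w x, finsupp (shrink_all w) != fset0 &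
      spread_le t (finsupp (shrink_all w))].
Proof.
move=> w0 wN0; have [n wn] := r_unbounded (finsupp w).
by rewrite (shrink_allE w0 wn); exact: shrinkP.
Qed.

Lemma wcvg_shrink {I : Type} (F : set_system I) {FF : Filter F} n
    (w : I -> {fsfun X -> R with 0}) w0 :
  wcvg F w w0 -> wcvg F (fun i => shrink n (w i)) (shrink n w0).
Proof. by elim: n w w0 => [//|n IH] w w0 /(wcvg_relabel (C n))/IH. Qed.

(** Along weights with supports in one finite set, a single number of stages
    will do. *)
Lemma wcvg_shrink_all {I : Type} (F : set_system I) {FF : Filter F}
    (w : I -> {fsfun X -> R with 0}) w0 :
  (forall i x, 0 <= w i x) -> (forall x, 0 <= w0 x) ->
  wcvg F w w0 -> wcvg F (fun i => shrink_all (w i)) (shrink_all w0).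
Proof.
move=> wp w0p ww; have [V [w0V wV] _] := ww.
have [n Vn] := r_unbounded V.
have [V' [w0V' wV'] ww'] := wcvg_shrink n ww.
have E i : (finsupp (w i) `<=` V)%fset -> shrink_all (w i) = shrink n (w i).
  by move=> wiV; apply: shrink_allE => //; exact: spread_le_sub Vn.
have E0 : shrink_all w0 = shrink n w0.
  by apply: shrink_allE => //; exact: spread_le_sub Vn.
rewrite E0; exists V'.
  by split=> //; apply: filterS2 wV wV' => i /E ->.
move=> x; apply: cvg_trans (ww' x); apply: near_eq_cvg.
by apply: filterS wV => i /E ->.
Qed.

Lemma shrink_all_fixed {G : groupType} (a : isom_action G X) g w :
  (forall n S, C n (a g @` S)%fset = (a g @` C n S)%fset) ->
  wfixed a g w -> wfixed a g (shrink_all w).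
Proof.
move=> Cg; rewrite /shrink_all; move: (xget _ _) => n; elim: n w => [//|n IH] w wg /=.
by apply: IH; exact: relabel_fixed.
Qed.

(** The segment to the indicator of [B] leaves scale [t]; the retraction brings
    it back. *)
Definition contraction_map (B : {fset X}) (z : R * VRX) : VRX :=
  of_weight z.2 (shrink_all (wseg B z.1 (weight z.2))).

Context (B : {fset X}) (B0 : B != fset0).

Lemma contraction_shrinkP s (p : VRX) :
  [/\ forall x, 0 <= shrink_all (wseg B s (weight p)) x,
      finsupp (shrink_all (wseg B s (weight p))) != fset0 &
      spread_le t (finsupp (shrink_all (wseg B s (weight p))))].
Proof.
apply: shrink_allP => [x|]; first by apply: wseg_ge0; exact: weight_ge0.
by apply: wseg_neq0 => //; [exact: weight_ge0|exact: weight_neq0].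
Qed.

Lemma contraction_map0 (p : VRX) : contraction_map B (0, p) = p.
Proof.
rewrite /contraction_map/= wseg0 (@shrink_allE 0%N)/= ?weightK//.
  exact: weight_ge0.
by rewrite r0; exact: weight_spread.
Qed.

Lemma contraction_map1 (p q : VRX) :
  contraction_map B (1, p) = contraction_map B (1, q).
Proof.
apply/val_inj; rewrite -[LHS]/(bary _) -[RHS]/(bary _).
have [p1 p2 p3] := contraction_shrinkP 1 p.
have [q1 q2 q3] := contraction_shrinkP 1 q.
by rewrite /contraction_map/= !of_weightE// (wseg1 _ _ (weight q)).
Qed.

Lemma contraction_map_fixed {G : groupType} (a : isom_action G X) g s (p : VRX) :
  (forall n S, C n (a g @` S)%fset = (a g @` C n S)%fset) ->
  (a g @` B)%fset = B -> VR_gaction t a g p = p ->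
  VR_gaction t a g (contraction_map B (s, p)) = contraction_map B (s, p).
Proof.
move=> Cg gB gp; have [p1 p2 p3] := contraction_shrinkP s p.
apply: of_weight_fixed => //; apply: shrink_all_fixed => //.
by apply: wseg_fixed => //; exact: weight_fixed.
Qed.

(** On one closed simplex all supports stay in a finite set, where the stages of
    the retraction are finite in number and given by finite sums and maxima. *)
Lemma contraction_map_simplex {I : Type} (F : set_system I) {FF : Filter F}
    (s : I -> R) (q : I -> VRX) s0 (p : VRX) (sigma : {fset VR_poset X t}) :
  s i @[i --> F] --> s0 -> closed_simplex sigma p ->
  (\forall i \near F, closed_simplex sigma (q i)) ->
  (forall S, bary (q i) S @[i --> F] --> bary p S) ->
  contraction_map B (s i, q i) @[i --> F] --> contraction_map B (s0, p).
Proof.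
move=> ss ps qs qp.
have wq : wcvg F (fun i => weight (q i)) (weight p).
  by apply: wcvg_comb => [i j|j|]; [exact: bary_ge0|exact: bary_ge0|exists sigma].
have ww : wcvg F (fun i => shrink_all (wseg B (s i) (weight (q i))))
    (shrink_all (wseg B s0 (weight p))).
  apply: wcvg_shrink_all => [i x|x|].
  - by apply: wseg_ge0; exact: weight_ge0.
  - by apply: wseg_ge0; exact: weight_ge0.
  - exact: wcvg_wseg.
have [V [_ wV] _] := ww; have [p1 p2 p3] := contraction_shrinkP s0 p.
apply: (@cvg_realization _ _ _ _ _ _ _ _
    (fset_set [set S : VR_poset X t | (val S `<=` V)%fset])).
  apply: filterS wV => i wiV; have [q1 q2 q3] := contraction_shrinkP (s i) (q i).
  apply/fsubsetP => S; rewrite of_weightE// mem_finsupp layer_baryE.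
  rewrite in_fset_set; last exact: finite_VR_below.
  move=> lS; apply/mem_set; apply: fsubset_trans wiV; apply: layer_sub.
  rewrite lt_neqAle layer_ge0 andbT eq_sym; apply: contra lS => /eqP ->.
  by rewrite mul0r.
move=> S; rewrite of_weightE// layer_baryE.
have E i : bary (contraction_map B (s i, q i)) S =
    layer (shrink_all (wseg B (s i) (weight (q i)))) (val S) /
    wmax (shrink_all (wseg B (s i) (weight (q i)))).
  by have [q1 q2 q3] := contraction_shrinkP (s i) (q i); rewrite of_weightE// layer_baryE.
under eq_cvg do rewrite E.
apply: cvgM; first exact: wcvg_layer.
by apply: cvgV; [rewrite gt_eqF// wmax_gt0|exact: wcvg_wmax].
Qed.

Lemma contraction_map_continuous : continuous (contraction_map B).
Proof.
apply: realization_homotopy_continuous => s0 p sigma _ ps.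
apply: (@contraction_map_simplex _ _ _ (fun z => z.1) (fun z => z.2) s0 p sigma).
- exact: cvg_fst.
- by [].
- by apply: (cvg_snd (F := nbhs s0)); exact: simplex_nbhs_closed.
- move=> S; apply: (@cvg_comp _ _ _ snd (fun q : VRX => bary q S)); first exact: cvg_snd.
  exact: simplex_nbhs_bary.
Qed.

End contraction.

(** * Universality from a compatible choice of centres *)

Section universal.
Context {R : realType} {X : metricType R} {G : groupType} (a : isom_action G X).
Context (t : R).
Local Notation VRX := (VR X t).
Local Notation aVR := (VR_gaction t a).

Lemma chain_rigid g (s : {fset VR_poset X t}) : VR_simplicial X t s ->
  (VR_poset_gaction t a g @` s)%fset = s ->
  {in s, forall S, VR_poset_gaction t a g S = S}.
Proof.
move=> [_ chain] gs S Ss; have gSs : VR_poset_act a g S \in s.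
  by rewrite -gs mem_act_fset (gactK (VR_poset_gaction t a)).
apply/val_inj/eqP => /=; have /orP[le|le] := chain _ _ Ss gSs.
  by rewrite eq_sym eqEfcard card_act leqnn andbT; exact: le.
by rewrite eqEfcard card_act leqnn andbT; exact: le.
Qed.

Lemma chain_spread (s : {fset VR_poset X t}) S S' x y : VR_simplicial X t s ->
  S \in s -> S' \in s -> x \in val S -> y \in val S' -> mdist x y <= t.
Proof.
move=> [_ chain] Ss S's xS yS'.
have [_ St] := VR_pointP S; have [_ S't] := VR_pointP S'.
have /orP[/fsubsetP SS|/fsubsetP SS] := chain _ _ Ss S's.
  by apply: S't => //; exact: SS.
by apply: St => //; exact: SS.
Qed.

Lemma VR_GCW : GCW_complex R aVR (@VR_cells R X t).
Proof. by apply: realization_GCW => g s; exact: chain_rigid. Qed.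

(** The sets of a chain lie within distance [t] of each of their points; moving
    one of these points to [x0] leaves finitely many chains. *)
Lemma VR_cocompact (x0 : X) : finite_set [set y | mdist x0 y <= t] ->
  (forall x, exists g, a g x = x0) -> cocompact aVR.
Proof.
move=> fin trans; pose D := fset_set [set y | mdist x0 y <= t].
apply: (@realization_cocompact _ _ _ _ _ _
  (fset_set [set S : VR_poset X t | (val S `<=` D)%fset])) => s Ks.
have [/fset0Pn[S Ss] _] := Ks; have [/fset0Pn[x xS] _] := VR_pointP S.
have [g gx] := trans x; exists g; apply/fsubsetP => _ /imfsetP[S' /= S's ->].
rewrite in_fset_set; last exact: finite_VR_below.
apply/mem_set/fsubsetP => _ /imfsetP[y /= yS' ->].
rewrite in_fset_set//; apply/mem_set => /=.
by rewrite -gx isom_mdist; exact: chain_spread Ks Ss S's xS yS'.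
Qed.

Lemma VR_proper (p : VRX) : (forall x y : X, finite_set [set g | a g x = y]) ->
  finite_set (stabilizer aVR p).
Proof.
move=> fin; have /fset0Pn[S Sp] := bary_neq0 p.
have [/fset0Pn[x xS] _] := VR_pointP S.
apply: (@sub_finite_set _ _ (\bigcup_(y in [set` val S]) [set g | a g x = y])).
  move=> g /= gp; exists (a g x) => //=.
  have sp : (VR_poset_gaction t a g @` finsupp (bary p))%fset = finsupp (bary p).
    by rewrite -[in RHS]gp finsupp_bary_act.
  rewrite -(chain_rigid (bary_simplex p) sp Sp) /= mem_act_fset gactK//.
by apply: bigcup_finite => [|y _]; [exact: finite_fset|exact: fin].
Qed.

Context (r : nat -> R) (C : nat -> {fset X} -> {fset X}).
Hypothesis r0 : r 0%N = t.
Hypothesis r_homo : forall n, r n <= r n.+1.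
Hypothesis r_unbounded : forall S : {fset X}, exists n, spread_le (r n) S.
Hypothesis C_id : forall n S, spread_le (r n) S -> C n S = S.
Hypothesis C_neq0 : forall n (S : {fset X}), S != fset0 -> C n S != fset0.
Hypothesis C_close : forall n S S' x y, (S `<=` S')%fset ->
  spread_le (r n.+1) S' -> x \in C n S -> y \in C n S' -> mdist x y <= r n.
Hypothesis C_act : forall n g (S : {fset X}), C n (a g @` S)%fset = (a g @` C n S)%fset.

(** The contraction towards the indicator of an invariant set preserves the
    fixed points, and its endpoint is one of them. *)
Lemma VR_fixed_contractible (H : set G) (B : {fset X}) : B != fset0 ->
  (forall g, H g -> (a g @` B)%fset = B) ->
  contractible R (set_type (fixed_points aVR H)).
Proof.
move=> B0 HB.
(* the indicator of [B] gives a first point of the fixed set *)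
pose w : {fsfun X -> R with 0} := comb [fset B]%fset (fun=> 1) id.
have w0 x : 0 <= w x by exact: comb_ge0.
have wN0 : finsupp w != fset0.
  have /fset0Pn[b bB] := B0; apply/fset0Pn; exists b; apply/comb_supp => //.
  by exists B; split; rewrite ?inE.
have [v0 vN0 vt] := shrink_allP r0 r_homo r_unbounded C_id C_neq0 C_close w0 wN0.
pose p0 : VRX := exist (fun f => f \in [set f | is_barycentric (VR_simplicial X t) f])
  _ (mem_set (layer_baryP v0 vN0 vt)).
pose p1 := of_weight p0 (shrink_all r C w).
have p1H : p1 \in fixed_points aVR H.
  apply/mem_set => g /HB gB; apply: of_weight_fixed => //.
  apply: shrink_all_fixed => //; apply: comb_fixed => // S.
  by rewrite inE => /eqP ->.
have cH s (y : set_type (fixed_points aVR H)) :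
    contraction_map r C B (s, val y) \in fixed_points aVR H.
  apply/mem_set => g Hg; apply: contraction_map_fixed => //; first exact: HB.
  by have /set_mem := valP y; apply.
pose h (z : R * set_type (fixed_points aVR H)) : set_type (fixed_points aVR H) :=
  exist (fun p => p \in fixed_points aVR H) _ (cH z.1 z.2).
exists (h (1, exist (fun p => p \in fixed_points aVR H) p1 p1H)).
exists h; split=> [|y|y].
- apply: continuous_subspaceT; apply: continuous_comp_initial.
  move=> z; apply: (@continuous_comp _ _ _
    (fun z : R * set_type (fixed_points aVR H) => (z.1, val z.2))
    (contraction_map r C B)).
    have z1 : fst @ nbhs z --> z.1 by exact: cvg_fst.
    have z2 : (val \o snd) @ nbhs z --> val z.2.
      apply: (@cvg_comp _ _ _ snd val _ (nbhs z.2)); first exact: cvg_snd.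
      exact: initial_continuous.
    exact: cvg_pair z1 z2.
  exact: contraction_map_continuous.
- by apply/val_inj; exact: contraction_map0.
- by apply/val_inj; exact: contraction_map1.
Qed.

Lemma orbit_fset_fixed (H : set G) (x : X) : is_subgroup H -> finite_set H ->
  exists2 B : {fset X}, B != fset0 & forall g, H g -> (a g @` B)%fset = B.
Proof.
move=> [H1 HM _] Hfin; pose B := fset_set [set a h x | h in H].
have BE y : (y \in B) = (y \in [set a h x | h in H]).
  by rewrite in_fset_set//; exact: finite_image.
exists B.
  apply/fset0Pn; exists x; rewrite BE; apply/mem_set.
  by exists 1%g => //; rewrite gact1.
move=> g Hg; apply/eqP; rewrite eqEfcard card_act leqnn andbT.
apply/fsubsetP => _ /imfsetP[y /= + ->]; rewrite !BE => /set_mem[h Hh <-].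
by apply/mem_set; exists (g * h)%g; [exact: HM|rewrite gactM].
Qed.

Lemma VR_universal (x0 : X) : finite_set [set y | mdist x0 y <= t] ->
  (forall x, exists g, a g x = x0) ->
  (forall x y : X, finite_set [set g | a g x = y]) ->
  finite_GCW_complex R aVR (@VR_cells R X t) /\
  universal_proper_space R aVR (@VR_cells R X t).
Proof.
move=> fin trans stab; split.
  by split; [exact: VR_GCW|exact: VR_cocompact fin trans].
split; first by split; [exact: VR_GCW|move=> p; exact: VR_proper].
move=> H subH finH; have [B B0 HB] := orbit_fset_fixed x0 subH finH.
exact: VR_fixed_contractible B0 HB.
Qed.

End universal.

(** * Comparison with a quarter point *)

Section comparison.
Context {R : realType}.

(** The third vertex of a triangle with two vertices at 0 and [(a, 0)]; the
    triangle inequalities say that the height is real. *)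
Lemma comparison_coords (a b e : R) : 0 <= a -> 0 <= b -> 0 <= e ->
  a <= b + e -> b <= a + e -> e <= a + b ->
  exists u v : R, u ^+ 2 + v ^+ 2 = b ^+ 2 /\ (a - u) ^+ 2 + v ^+ 2 = e ^+ 2.
Proof.
move=> a0 b0 e0 abe bae eab; have [az|an] := eqVneq a 0.
  exists b, 0; have -> : e = b by lra.
  by rewrite az; split; ring.
have ap : 0 < a by rewrite lt_neqAle eq_sym an.
pose u := (a ^+ 2 + b ^+ 2 - e ^+ 2) / (2 * a).
have ua : 2 * a * u = a ^+ 2 + b ^+ 2 - e ^+ 2.
  by rewrite /u mulrC divfK// mulf_neq0// pnatr_eq0.
have u2 : u ^+ 2 <= b ^+ 2.
  have h1 : 0 <= 2 * a * (b - u).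
    rewrite mulrBr ua; have := mulr_ge0 (_ : 0 <= e - (a - b)) (_ : 0 <= e + (a - b)).
    have e1 : 0 <= e - (a - b) by lra.
    have e2 : 0 <= e + (a - b) by lra.
    by move=> /(_ e1 e2); nra.
  have h2 : 0 <= 2 * a * (b + u).
    rewrite mulrDr ua; have e1 : 0 <= a + b - e by lra.
    have e2 : 0 <= a + b + e by lra.
    by have := mulr_ge0 e1 e2; nra.
  have p2 : 0 < 2 * a by lra.
  rewrite pmulr_rge0// in h1; rewrite pmulr_rge0// in h2.
  by rewrite -subr_ge0 subr_sqr mulr_ge0.
exists u, (Num.sqrt (b ^+ 2 - u ^+ 2)); rewrite sqr_sqrtr ?subr_ge0//.
by split; [ring|nra].
Qed.

Definition vec2 (u v : R) : 'rV[R]_2 := \row_j (if j == ord0 then u else v).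

Lemma enorm_vec2 u v : enorm (vec2 u v) = Num.sqrt (u ^+ 2 + v ^+ 2).
Proof. by rewrite /enorm big_ord_recl big_ord1 !mxE. Qed.

Lemma vec2B u v u' v' : vec2 u v - vec2 u' v' = vec2 (u - u') (v - v').
Proof. by apply/rowP => j; rewrite !mxE; case: ifP. Qed.

Definition triple {T : Type} (x y z : T) (i : 'I_3) : T := nth z [:: x; y] i.

Context {X : metricType R}.

Lemma geodesic_segment_sym (x y : X) S :
  geodesic_segment x y S -> geodesic_segment y x S.
Proof.
move=> [c [c0 c1 cd] ->]; have dyx : mdist y x = mdist x y by exact: metric_sym.
have itvE s : s \in `[0, mdist y x] -> mdist x y - s \in `[0, mdist x y].
  by rewrite !in_itv/= dyx => /andP[? ?]; apply/andP; split; lra.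
exists (fun s => c (mdist x y - s)); first split.
- by rewrite subr0.
- by rewrite dyx subrr.
- move=> s s' /itvE si /itvE s'i; rewrite cd// distrC.
  by congr `|_|; ring.
apply/seteqP; split=> [_ [s si <-]|_ [s si <-]].
  exists (mdist x y - s); last by rewrite subKr.
  by move: si; rewrite /= !in_itv/= dyx => /andP[? ?]; apply/andP; split; lra.
exists (mdist x y - s) => //.
by move: si; rewrite /= !in_itv/= dyx => /andP[? ?]; apply/andP; split; lra.
Qed.

(** The Euclidean distance [q] from the opposite vertex to the point at one
    quarter of a side is given by the theorem of Stewart. The error is at most
    [e * t] for triangles of size at most [3 * t]: large triangles by
    sublinearity, and the others because their size is bounded. *)
Lemma quarter_point : asymptotically_CAT0 X -> forall e : R, 0 < e ->
  exists2 T : R, 0 < T & forall t, T <= t -> forall c x : X,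
    mdist c x <= 3 * t -> exists m : X, forall s,
    mdist c s <= 3 * t -> mdist x s <= 3 * t -> exists q : R,
    [/\ 0 <= q,
        q ^+ 2 = 3 / 4 * mdist c s ^+ 2 + 1 / 4 * mdist x s ^+ 2
                 - 3 / 16 * mdist c x ^+ 2 &
        mdist m s <= q + e * t].
Proof.
move=> [geo [sigma sub cat]] e e0.
have e3 : 0 < e / 3 by rewrite divr_gt0.
have [T0 [_ sT]] := cvgr_dist_lt _ _ sub _ e3.
pose T1 := Num.max 1 (T0 + 1).
have T1_ge1 : 1 <= T1 by rewrite le_max lexx.
have sigmaT u : T1 <= u -> sigma u <= e / 3 * u.
  move=> uT; have u0 : 0 < u by apply: lt_le_trans ltr01 (le_trans T1_ge1 uT).
  have /sT : T0 < u by apply: lt_le_trans uT; rewrite lt_max ltrDl ltr01 orbT.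
  rewrite sub0r normrN => /ltW /(le_trans (ler_norm _)).
  by rewrite ler_pdivrMr.
(* small triangles have size at most [T1], where the trivial bound is [2 * T1] *)
exists (Num.max 1 (2 * T1 / e)); first by rewrite lt_max ltr01.
move=> t; rewrite ge_max => /andP[t1 tT] c x cx.
have [? [gam gamP _]] := geo c x; have [gam0 gam1 gamd] := gamP.
set a := mdist c x in cx gam1 gamd *.
have a0 : 0 <= a by exact: mdist_ge0.
have qi : a / 4 \in `[0, a] by rewrite in_itv/=; apply/andP; split; lra.
exists (gam (a / 4)) => s; set b := mdist c s; set d := mdist x s => bt dt.
have b0 : 0 <= b by exact: mdist_ge0.
have d0 : 0 <= d by exact: mdist_ge0.
have abd : a <= b + d by rewrite /d (metric_sym x s); exact: metric_triangle.
have bad : b <= a + d by exact: metric_triangle.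
have dab : d <= a + b by rewrite /a (metric_sym c x); exact: metric_triangle.
have [u [v [uvb uvd]]] := comparison_coords a0 b0 d0 abd bad dab.
exists (Num.sqrt ((a / 4 - u) ^+ 2 + v ^+ 2)).
split; first exact: sqrtr_ge0.
  rewrite sqr_sqrtr; last by rewrite addr_ge0// sqr_ge0.
  by rewrite -uvb -uvd; field.
have cm : mdist c (gam (a / 4)) = a / 4.
  rewrite -{1}gam0 gamd//; last by rewrite in_itv/= lexx.
  by rewrite sub0r normrN ger0_norm// divr_ge0.
have [? [gam2 gam2P _]] := geo c s; have [A12 A12P] := geo x s.
pose A01 := gam @` `[0, a]%classic; pose A02 := gam2 @` `[0, b]%classic.
have A01P : geodesic_segment c x A01 by exists gam.
have A02P : geodesic_segment c s A02 by exists gam2.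
(* sides are indexed by [i + j], which is 1, 2, 3 for the three sides *)
pose p := triple c x s; pose side (i j : 'I_3) := nth A12 [:: A01; A01; A02] (i + j).
pose pbar := triple (vec2 0 0) (vec2 a 0) (vec2 u v).
have tri : geodesic_triangle p side.
  split; last by move=> i j; rewrite /side addnC.
  move=> [[|[|[|//]]] i3] [[|[|[|//]]] j3] //= _; rewrite /p /side /triple /=;
    by [|exact: geodesic_segment_sym].
have cmp : comparison_triangle p pbar.
  have e00 w : enorm (w - w) = 0 :> R.
    by rewrite subrr (eqP (etrans (enorm_eq0 _) (eqxx _))).
  have eN (w w' : 'rV[R]_2) : enorm (w - w') = enorm (w' - w).
    by rewrite -opprB -scaleN1r enormZ normrN1 mul1r.
  have E01 : a = enorm (vec2 0 0 - vec2 a 0).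
    by rewrite vec2B enorm_vec2 !sub0r sqrrN oppr0 expr0n addr0 sqrtr_sqr ger0_norm.
  have E02 : b = enorm (vec2 0 0 - vec2 u v).
    by rewrite vec2B enorm_vec2 !sub0r !sqrrN uvb sqrtr_sqr ger0_norm.
  have E12 : d = enorm (vec2 a 0 - vec2 u v).
    by rewrite vec2B enorm_vec2 sub0r sqrrN uvd sqrtr_sqr ger0_norm.
  move=> [[|[|[|//]]] i3] [[|[|[|//]]] j3]; rewrite /p /pbar /triple /=;
    by rewrite ?mdistxx ?e00// 1?eN// metric_sym.
have size_le : triangle_size p <= 3 * t.
  have t0 : 0 <= 3 * t by lra.
  apply: bigmax_le => // i _; apply: bigmax_le => // j.
  by case: i j => [[|[|[|//]]] i3] [[|[|[|//]]] j3] //= _; rewrite /p /triple.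
have size_ge : a <= triangle_size p /\ b <= triangle_size p.
  pose o1 : 'I_3 := Ordinal (isT : (1 < 3)%N).
  pose o2 : 'I_3 := Ordinal (isT : (2 < 3)%N).
  split; apply: (@bigmax_sup _ _ _ _ ord0) => //.
    by apply: (@bigmax_sup _ _ _ _ o1).
  by apply: (@bigmax_sup _ _ _ _ o2).
have [small|big] := ltP (triangle_size p) T1.
  have : mdist (gam (a / 4)) s <= a / 4 + b.
    by rewrite -[X in _ <= X + _]cm (metric_sym c); exact: metric_triangle.
  move: tT; rewrite ler_pdivrMr// => tT; move: size_ge => [ga gb] ms.
  have := sqrtr_ge0 ((a / 4 - u) ^+ 2 + v ^+ 2).
  by move: tT; rewrite mulrC; lra.
have h : mdist (gam (a / 4)) s <=
    enorm (vec2 (a / 4) 0 - vec2 u v) + sigma (triangle_size p).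
  apply: (cat p side pbar tri cmp ord0 (Ordinal (isT : (1 < 3)%N)) ord0
    (Ordinal (isT : (2 < 3)%N))) => //.
  - by exists (a / 4).
  - by exists b; [rewrite /= in_itv/= lexx b0|case: gam2P].
  - split; last first.
      rewrite /pbar /p /triple/= vec2B enorm_vec2 !sub0r sqrrN oppr0 expr0n addr0.
      by rewrite sqrtr_sqr ger0_norm// divr_ge0.
    exists (1 / 4); first by rewrite /= in_itv/=; apply/andP; split; lra.
    by apply/rowP => j; rewrite /pbar /triple/= !mxE; case: ifP => _; field.
  - split; last by have := cmp ord0 (Ordinal (isT : (2 < 3)%N)).
    exists 1; first by rewrite /= in_itv/= lexx ler01.
    by rewrite subrr scale0r scale1r add0r.
move: h; rewrite vec2B enorm_vec2 sub0r sqrrN => /le_trans; apply.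
rewrite lerD2l; apply: le_trans (sigmaT _ big) _.
rewrite -mulrA ler_pM2l// mulrC ler_pdivrMr//.
by rewrite mulrC.
Qed.

End comparison.

(** * Circumcentres at large scale *)

Section centers.
Context {R : realType} {Y : metricType R}.
Implicit Types (S : {fset Y}) (x y c : Y).

(** Its infimum over [x] is the circumradius of [S]. *)
Definition farthest S x : R := \big[Num.max/0]_(s <- S) mdist x s.

Lemma farthest_ge S x s : s \in S -> mdist x s <= farthest S x.
Proof. by move=> sS; exact: le_bigmax_seq. Qed.

Lemma farthest_attained S x : S != fset0 ->
  exists2 s, s \in S & farthest S x = mdist x s.
Proof.
move=> /fset0Pn[s sS].
have [r0|//] := bigmax_attained (enum_fset S) (fun s => mdist x s) 0.
exists s => //; apply/le_anti; rewrite farthest_ge// andbT.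
by rewrite /farthest r0 mdist_ge0.
Qed.

Lemma farthest_sub S S' x : (S `<=` S')%fset -> farthest S x <= farthest S' x.
Proof. by move=> /fsubsetP SS'; exact: sub_bigmax_seq. Qed.

(** All minimisers are kept: this makes the construction canonical, hence
    equivariant. *)
Definition centers S : {fset Y} :=
  fset_set [set x | forall y, farthest S x <= farthest S y].

Hypothesis locally_finite :
  forall x (rho : R), finite_set [set y | mdist x y <= rho].

Lemma centersP S c : S != fset0 ->
  reflect (forall y, farthest S c <= farthest S y) (c \in centers S).
Proof.
move=> S0; rewrite in_fset_set.
  by apply: (iffP idP) => [/set_mem//|?]; exact/mem_set.
have /fset0Pn[s sS] := S0.
apply: sub_finite_set (locally_finite s (farthest S s)) => x /(_ s) /=.
by apply: le_trans; rewrite metric_sym; exact: farthest_ge.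
Qed.

(** Outside a finite ball around a point of [S], the function to minimise exceeds
    its value at that point. *)
Lemma centers_neq0 S : S != fset0 -> centers S != fset0.
Proof.
move=> S0; have /fset0Pn[s sS] := S0.
pose D := fset_set [set y | mdist s y <= farthest S s].
have DE y : (y \in D) = (mdist s y <= farthest S s).
  rewrite in_fset_set; last exact: locally_finite.
  by apply/idP/idP => [/set_mem|/mem_set].
have sD : s \in D by rewrite DE mdistxx; exact: bigmax_ge_id.
have D0 : D != fset0 by apply/fset0Pn; exists s.
have [c cD cmax] := fset_argmax (fun y => - farthest S y) D0.
apply/fset0Pn; exists c; apply/centersP => // y.
have [yD|yD] := boolP (y \in D); first by rewrite -lerN2 cmax.
have cs : farthest S c <= farthest S s by rewrite -lerN2 cmax.
apply: le_trans cs _; move: yD; rewrite DE -ltNge => /ltW/le_trans; apply.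
by rewrite metric_sym; exact: farthest_ge.
Qed.

(** Keeping the small sets is what makes the induced map a retraction. *)
Definition recenter (t : R) S : {fset Y} :=
  if `[< spread_le t S >] then S else centers S.

Lemma recenter_id t S : spread_le t S -> recenter t S = S.
Proof. by move=> St; rewrite /recenter; case: asboolP. Qed.

Lemma recenter_neq0 t S : S != fset0 -> recenter t S != fset0.
Proof.
by move=> S0; rewrite /recenter; case: asboolP => // _; exact: centers_neq0.
Qed.

Context {G : groupType} (a : isom_action G Y).

Lemma farthest_act g S x : farthest (a g @` S)%fset (a g x) = farthest S x.
Proof.
apply/le_anti/andP; split; rewrite /farthest big_seq; apply: bigmax_le;
  rewrite ?bigmax_ge_id// => s.
  by move=> /imfsetP[s' /= s'S ->]; rewrite isom_mdist; exact: farthest_ge.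
by move=> sS; rewrite -(isom_mdist a g); apply: farthest_ge; exact: in_imfset.
Qed.

Lemma centers_act g S : S != fset0 ->
  centers (a g @` S)%fset = (a g @` centers S)%fset.
Proof.
move=> S0; have gS0 : (a g @` S)%fset != fset0.
  have /fset0Pn[s sS] := S0; apply/fset0Pn; exists (a g s); exact: in_imfset.
apply/fsetP => x; rewrite mem_act_fset.
have rE y : farthest (a g @` S)%fset y = farthest S (a g^-1%g y).
  by rewrite -{1}(gactVK a g y) farthest_act.
apply/(centersP _ gS0)/(centersP _ S0) => h y; last by rewrite !rE.
by have := h (a g y); rewrite !rE gactK.
Qed.

Lemma recenter_act t g S :
  recenter t (a g @` S)%fset = (a g @` recenter t S)%fset.
Proof.
have spread_act : spread_le t (a g @` S)%fset <-> spread_le t S.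
  split=> St x y.
    by move=> xS yS; rewrite -(isom_mdist a g); apply: St; exact: in_imfset.
  by move=> /imfsetP[x' /= xS ->] /imfsetP[y' /= yS ->]; rewrite isom_mdist St.
rewrite /recenter; case: asboolP => [/spread_act St|St]; case: asboolP => // St'.
  by case: St; exact/spread_act.
by apply: centers_act; apply: contra_notN St' => /eqP-> x y; rewrite inE.
Qed.

End centers.

Section coarse_centers.
Context {R : realType} {X : metricType R} (A : set X).
Local Notation Y := (set_type A : metricType R).
Hypothesis cat : asymptotically_CAT0 X.
Hypothesis locally_finite :
  forall (x : Y) (rho : R), finite_set [set y | mdist x y <= rho].
Hypothesis coarsely_dense : exists D : R,
  forall z : X, exists y : Y, mdist z (val y) <= D.
Implicit Types (S : {fset Y}) (x y c : Y).

(** Move from the centre [c] a quarter of the way towards [x]. By minimality the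
    largest distance to [S] does not decrease, up to the error of passing to a
    nearby point of [A]; by convexity it is bounded in terms of the distances
    from [c] and [x]. A full CAT(0) inequality would have the coefficient 1
    instead of [3 / 4], obtained by moving by an infinitesimal fraction, but then
    the error would be divided by this fraction. *)
Lemma center_inequality (eta : R) : 0 < eta -> exists2 T : R, 0 < T &
  forall t, T <= t -> forall S c x, S != fset0 -> c \in centers S ->
    farthest S c <= 3 * t -> farthest S x <= 3 * t -> mdist c x <= 3 * t ->
    farthest S c ^+ 2 + 3 / 4 * mdist c x ^+ 2 <=
      farthest S x ^+ 2 + eta * t ^+ 2.
Proof.
move=> eta0.
(* the errors will add up to [64 * e * t ^+ 2] *)
pose e := Num.min 1 (eta / 64).
have [e0 e1 eeta] : [/\ 0 < e, e <= 1 & 64 * e <= eta].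
  split; first by rewrite lt_min ltr01 divr_gt0.
  - by rewrite ge_min lexx.
  - by rewrite mulrC -ler_pdivlMr// ge_min lexx orbT.
have [T T0 TP] := quarter_point cat e0; have [D DP] := coarsely_dense.
exists (Num.max T (D / e)); first by rewrite lt_max T0.
move=> t; rewrite ge_max ler_pdivrMr// => /andP[Tt Dt] S c x S0 cS ct xt cx.
have t0 : 0 < t by exact: lt_le_trans Tt.
have [m mP] := TP t Tt (val c) (val x) cx; have [m' mm'] := DP m.
have [s sS sE] := farthest_attained m' S0.
have cs := farthest_ge c sS; have xs := farthest_ge x sS.
have [q [q0 qE mq]] := mP (val s) (le_trans cs ct) (le_trans xs xt).
have rq : farthest S c <= q + 2 * (e * t).
  apply: (le_trans ((centersP locally_finite _ S0 cS) m')); rewrite sE.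
  apply: (le_trans (metric_triangle (val m') m (val s))).
  by rewrite (metric_sym (val m')); move: mm' mq; lra.
have r0 : 0 <= farthest S c by exact: bigmax_ge_id.
have F0 : 0 <= farthest S x by exact: bigmax_ge_id.
have cs0 : 0 <= mdist c s by exact: mdist_ge0.
have xs0 : 0 <= mdist x s by exact: mdist_ge0.
change (mdist (val c) (val s)) with (mdist c s) in qE.
change (mdist (val x) (val s)) with (mdist x s) in qE.
change (mdist (val c) (val x)) with (mdist c x) in qE.
move: (farthest S c) (farthest S x) (mdist c s) (mdist x s) (mdist c x)
  cs xs qE rq r0 F0 cs0 xs0 ct xt => r F b d l br dF qE rq r0 F0 b0 d0 rt Ft.
have b2 : b ^+ 2 <= r ^+ 2 by rewrite ler_sqr.
have d2 : d ^+ 2 <= F ^+ 2 by rewrite ler_sqr.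
have r9 : r ^+ 2 <= (3 * t) ^+ 2 by rewrite ler_sqr// nnegrE; lra.
have F9 : F ^+ 2 <= (3 * t) ^+ 2 by rewrite ler_sqr// nnegrE; lra.
have q3 : q <= 3 * t.
  have t3 : 0 <= 3 * t by lra.
  by rewrite -ler_sqr ?nnegrE//; have := sqr_ge0 l; lra.
have et0 : 0 <= e * t by rewrite mulr_ge0// ltW.
have r2 : r ^+ 2 <= (q + 2 * (e * t)) ^+ 2 by rewrite ler_sqr// nnegrE; lra.
have qet : q * (e * t) <= 3 * t * (e * t) by exact: ler_wpM2r.
have ett : e * t * (e * t) <= e * t * t.
  by rewrite ler_wpM2l// -[leRHS]mul1r ler_wpM2r// ltW.
have fin : 64 * e * t ^+ 2 <= eta * t ^+ 2 by rewrite ler_wpM2r// sqr_ge0.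
have -> : r ^+ 2 = 4 * r ^+ 2 - 3 * r ^+ 2 by ring.
have : r ^+ 2 <= q ^+ 2 + 16 * (e * t ^+ 2).
  apply: le_trans r2 _.
  have -> : (q + 2 * (e * t)) ^+ 2 =
    q ^+ 2 + 4 * (q * (e * t)) + 4 * (e * t * (e * t)) by ring.
  by have E : 16 * (e * t ^+ 2) = 4 * (3 * t * (e * t)) + 4 * (e * t * t); [ring|lra].
by rewrite qE; lra.
Qed.

(** Applied to the centre of a set of diameter at most [11/10 * t] and to a point
    of the set at largest distance from the centre, [center_inequality] gives a
    radius [rho] with [7/4 * rho^2 <= (11/10)^2 * t^2] up to the error; applied
    to the centres of nested sets it gives a distance [l] with
    [3/4 * l^2 <= rho^2], again up to the error. The constants leave room for an
    error of [t^2 / 50] each time. *)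
Lemma recenter_close : exists2 T : R, 0 < T & forall t, T <= t ->
  forall S S' x y, (S `<=` S')%fset -> spread_le (11 / 10 * t) S' ->
    x \in recenter t S -> y \in recenter t S' -> mdist x y <= t.
Proof.
have eta0 : 0 < 1 / 50 :> R by rewrite divr_gt0.
have [T T0 TP] := center_inequality eta0; exists T => // t Tt.
have t0 : 0 < t by exact: lt_le_trans Tt.
have rad S c : S != fset0 -> spread_le (11 / 10 * t) S -> c \in centers S ->
    farthest S c <= t /\ farthest S c ^+ 2 <= 71 / 100 * t ^+ 2.
  move=> S0 St cS; have [s sS cs] := farthest_attained c S0.
  have st : farthest S s <= 11 / 10 * t.
    by have [s' s'S ->] := farthest_attained s S0; exact: St.
  have ct : farthest S c <= 11 / 10 * t.
    by apply: le_trans st; exact: (centersP locally_finite _ S0 cS).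
  have H := TP t Tt S c s S0 cS.
  have r0 : 0 <= farthest S c by exact: bigmax_ge_id.
  have s0 : 0 <= farthest S s by exact: bigmax_ge_id.
  have s2 : farthest S s ^+ 2 <= 121 / 100 * t ^+ 2.
    rewrite (_ : _ * _ = (11 / 10 * t) ^+ 2); last by field.
    by rewrite ler_sqr// nnegrE; lra.
  have main : farthest S c ^+ 2 <= 71 / 100 * t ^+ 2.
    have := H ltac:(lra) ltac:(lra) ltac:(lra); rewrite -cs.
    by have := sqr_ge0 t; lra.
  split=> //; rewrite -ler_sqr ?nnegrE//; last exact: ltW.
  by have := sqr_ge0 t; lra.
move=> S S' x y SS' S't; rewrite /recenter.
case: asboolP => [St|St]; case: asboolP => [S't'|S't'] xS yS'.
- by apply: S't' => //; exact: (fsubsetP SS').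
- have xS' := fsubsetP SS' _ xS.
  have S'0 : S' != fset0 by apply/fset0Pn; exists x.
  by rewrite metric_sym (le_trans (farthest_ge y xS'))//; have [] := rad _ _ S'0 S't yS'.
- by case: St; exact: spread_le_sub SS' S't'.
have S0 : S != fset0 by apply: contra_notN St => /eqP-> u v.
have S'0 : S' != fset0.
  by apply: contraNneq S0 => S'0; rewrite S'0 fsubset0 in SS'.
have [r't r'2] := rad _ _ S'0 S't yS'.
have yr : farthest S y <= farthest S' y by exact: farthest_sub.
have xr : farthest S x <= farthest S y by exact: (centersP locally_finite _ S0 xS).
have y0 : 0 <= farthest S y by exact: bigmax_ge_id.
have x0 : 0 <= farthest S x by exact: bigmax_ge_id.
have xy2 : mdist x y <= 2 * t.
  have [s sS ys] := farthest_attained y S0.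
  have := metric_triangle x s y; rewrite (metric_sym s y) -ys.
  by have := farthest_ge x sS; lra.
have := TP t Tt S x y S0 xS ltac:(lra) ltac:(lra) ltac:(lra).
have yr2 : farthest S y ^+ 2 <= farthest S' y ^+ 2 by rewrite ler_sqr// nnegrE; lra.
have t2 := sqr_ge0 t; have x2 := sqr_ge0 (farthest S x) => H.
by rewrite -ler_sqr ?nnegrE ?mdist_ge0//; lra.
Qed.

End coarse_centers.

(** * Orbits of proper cocompact actions *)

Section proper_cocompact.
Context {R : realType} {X : metricType R} {G : groupType} (a : isom_action G X).
Hypothesis geo : geodesic_space X.
Hypothesis proper : proper_action a.
Hypothesis cocpt : cocompact a.
Implicit Types (x y z : X) (g h : G).

Lemma act_mdistV g x y : mdist (a g x) y = mdist x (a g^-1%g y).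
Proof. by rewrite -{1}(gactVK a g y) isom_mdist. Qed.

(** Properness is uniform on the compact set by a covering argument, and the
    translates of a point inherit its constant by conjugation. *)
Lemma uniform_properness : exists2 e : R, 0 < e &
  forall x, finite_set [set g | a g @` ball x e `&` ball x e !=set0].
Proof.
have [K cK KX] := cocpt.
pose fin x (e : R) := finite_set [set g | a g @` ball x e `&` ball x e !=set0].
have finS x x' e e' : ball x e `<=` ball x' e' -> fin x' e' -> fin x e.
  move=> sub; apply: sub_finite_set => g [z [[y /sub xy <-] /sub xz]].
  by exists (a g y); split=> //; exists y.
have : \forall e \near (0 : R)^'+, K `<=` (fun x => fin x e).
  apply: (compact_near_coveringP K).1 => // x _.
  have [d d0 dfin] := proper x; have d2 : 0 < d / 2 by rewrite divr_gt0.
  exists (ball x (d / 2), [set e | e < d / 2]).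
    by split; [exact: nbhsx_ballx|exact: nbhs_right_lt].
  move=> [x' e] /= [xx' ed]; apply: finS dfin => y; rewrite !ballEmdist/= => x'y.
  apply: le_lt_trans (metric_triangle x x' y) _.
  by move: xx'; rewrite ballEmdist/= => xx'; lra.
move=> KE; have [e [e0 Ke]] : exists e : R, 0 < e /\ K `<=` (fun x => fin x e).
  by near (0 : R)^'+ => e; exists e; split; near: e; first exact: nbhs_right_gt.
exists e => // x.
have : [set: X] x by []; rewrite KX => -[h _ [k Kk <-]].
have ballh z : ball (a h k) e z -> ball k e (a h^-1%g z).
  by rewrite !ballEmdist/= act_mdistV.
apply: (@sub_finite_set _ _ [set (h * g * h^-1)%g | g in
    [set g | a g @` ball k e `&` ball k e !=set0]]).
  move=> g [_ [[z /ballh kz <-] /ballh kgz]].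
  exists (h^-1 * g * h)%g; last by rewrite !mulgA mulgV mul1g mulgK.
  exists (a h^-1%g (a g z)); split=> //; exists (a h^-1%g z) => //.
  by rewrite !gactM gactVK.
by apply: finite_image; exact: Ke.
Unshelve. all: by end_near. Qed.

Lemma finite_net (e : R) : 0 < e -> exists N : {fset X},
  forall z, exists h, exists2 n, n \in N & mdist z (a h n) < e.
Proof.
move=> e0; have [K cK KX] := cocpt.
(* finite sets, ordered by inclusion, as the parameters of the covering *)
pose F : set_system {fset X} :=
  filter_from setT (fun N => [set N' | (N `<=` N')%fset]).
have FF : Filter F.
  apply: filter_from_filter; first by exists fset0.
  move=> N N' _ _; exists (N `|` N')%fset => // N1 /=.
  by rewrite fsubUset => /andP[].
have /compact_near_coveringP/(_ _ F
  (fun N x => exists2 n, n \in N & mdist x n < e) FF) := cK.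
case=> [x _|N _ /(_ N (fsubset_refl _)) KN].
  exists (ball x e, [set N : {fset X} | x \in N]).
    split; first exact: nbhsx_ballx.
    by exists [fset x]%fset => // N; rewrite /= fsub1set.
  move=> [x' N] /= [xx' xN]; exists x => //.
  by move: xx'; rewrite ballEmdist/= metric_sym.
exists N => z; have : [set: X] z by []; rewrite KX => -[h _ [k Kk <-]].
have [n Nn kn] := KN _ Kk; exists h, n => //.
by rewrite isom_mdist.
Qed.

(** Along a geodesic from [x] to [g z], the point at a fixed distance from [x]
    is close to the orbit of the net, and only finitely many elements of that
    orbit are close to [x]: so the finiteness propagates to larger radii. *)
Lemma finite_displacement x y (rho : R) :
  finite_set [set g | mdist (a g x) y <= rho].
Proof.
have [d d0 dfin] := uniform_properness.
have base u v : finite_set [set g | mdist (a g u) v < d].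
  have [->|/set0P[g0 g0P]] := eqVneq [set g | mdist (a g u) v < d] set0.
    exact: finite_set0.
  apply: (@sub_finite_set _ _ [set (g * g0)%g | g in
      [set g | a g @` ball v d `&` ball v d !=set0]]); last exact: finite_image.
  move=> g gP; exists (g * g0^-1)%g; last by rewrite mulgVK.
  exists (a g u); split; last by rewrite ballEmdist/= metric_sym.
  exists (a g0 u); first by rewrite ballEmdist/= metric_sym.
  by rewrite gactM gactK.
pose e := d / 4; have e0 : 0 < e by rewrite divr_gt0.
have [N NP] := finite_net e0.
have step n : forall u v, finite_set [set g | mdist (a g u) v < n%:R * e].
  elim: n => [|n IH] u v.
    rewrite (_ : [set _ | _] = set0) ?mul0r; first exact: finite_set0.
    by apply/seteqP; split=> // g /=; rewrite ltNge mdist_ge0.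
  apply: (@sub_finite_set _ _ ([set g | mdist (a g u) v < d] `|`
     \bigcup_(m in [set` N]) \bigcup_(h in [set h | mdist (a h m) v < d])
       [set g | mdist (a g u) (a h m) < n%:R * e])); last first.
    rewrite finite_setU; split; first exact: base.
    apply: bigcup_finite => [|m _]; first exact: finite_fset.
    by apply: bigcup_finite => [|h _]; [exact: base|exact: IH].
  move=> g /=; rewrite -natr1 mulrDl mul1r => guv.
  have [lt|ge] := ltP (mdist (a g u) v) d; [by left|right].
  have [? [c [c0 c1 cd] _]] := geo v (a g u); set l := mdist v (a g u) in c1 cd.
  have lE : l = mdist (a g u) v by exact: metric_sym.
  have pi : 2 * e \in `[0, l].
    by rewrite in_itv/= lE; apply/andP; split; rewrite /e in e0 *; lra.
  have l0 : 0 \in `[0, l] by rewrite in_itv/= lexx mdist_ge0.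
  have ll : l \in `[0, l] by rewrite in_itv/= lexx mdist_ge0.
  have vp : mdist v (c (2 * e)) = 2 * e.
    by rewrite -{1}c0 cd// sub0r normrN gtr0_norm// mulr_gt0.
  have pg : mdist (a g u) (c (2 * e)) = l - 2 * e.
    rewrite -{1}c1 cd// ger0_norm// subr_ge0.
    by move: pi; rewrite in_itv/= => /andP[].
  have [h [m mN pm]] := NP (c (2 * e)); exists m => //; exists h => /=.
    have := metric_triangle v (c (2 * e)) (a h m); rewrite vp (metric_sym v).
    by rewrite /e in pm *; lra.
  have := metric_triangle (a g u) (c (2 * e)) (a h m); rewrite pg lE.
  by move: guv pm; lra.
have [r0|r0] := ltP rho 0.
  rewrite (_ : [set _ | _] = set0); first exact: finite_set0.
  by apply/seteqP; split=> // g /= /le_lt_trans/(_ r0); rewrite ltNge mdist_ge0.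
apply: sub_finite_set (step (Num.bound (rho / e)) x y) => g /= /le_lt_trans; apply.
by rewrite -ltr_pdivrMr// archi_boundP// divr_ge0// ltW.
Qed.

Context (x0 : X).
Local Notation Y := (orbit_space a x0).
Local Notation aY := (orbit_isom_action a x0).

Lemma orbit_transitive (x y : Y) : exists g, aY g x = y.
Proof.
have /set_mem[g _ gx] := valP x; have /set_mem[h _ hy] := valP y.
exists (h * g^-1)%g; apply/val_inj => /=.
by rewrite -gx -hy gactM gactK.
Qed.

Lemma orbit_locally_finite (x : Y) (rho : R) : finite_set [set y | mdist x y <= rho].
Proof.
apply: (@sub_finite_set _ _ [set aY g x | g in
    [set g | mdist (a g (val x)) (val x) <= rho]]); last first.
  by apply: finite_image; exact: finite_displacement.
move=> y /= xy; have [g gy] := orbit_transitive x y; exists g => //=.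
by rewrite metric_sym; move: xy; rewrite -gy.
Qed.

Lemma orbit_finite_transporter (x y : Y) : finite_set [set g | aY g x = y].
Proof.
apply: sub_finite_set (finite_displacement (val x) (val y) 0) => g /= <-.
by rewrite /= mdistxx.
Qed.

Lemma orbit_coarsely_dense : exists D : R,
  forall z : X, exists y : Y, mdist z (val y) <= D.
Proof.
have [N NP] := finite_net ltr01.
exists (1 + \big[Num.max/0]_(n <- N) mdist n x0) => z.
have [h [n nN zn]] := NP z.
have hx : a h x0 \in Defs.orbit a x0 by apply/mem_set; exists h.
exists (exist (fun x => x \in Defs.orbit a x0) _ hx) => /=.
apply: le_trans (metric_triangle z (a h n) _) _; apply: lerD; first exact: ltW.
by rewrite isom_mdist; exact: (@le_bigmax_seq _ _ _ _ _ n xpredT (fun n => mdist n x0)).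
Qed.

End proper_cocompact.


(** * Growing scales and the theorem *)

Section scales.
Context {R : realType} {Y : metricType R} (t : R).

Definition scale (n : nat) : R := (11 / 10) ^+ n * t.

Lemma scale_ge n : 0 < t -> t <= scale n.
Proof.
move=> t0; rewrite /scale; apply: ler_peMl; first exact: ltW.
by apply: exprn_ege1; lra.
Qed.

Lemma scaleS n : scale n.+1 = 11 / 10 * scale n.
Proof. by rewrite /scale exprS mulrA. Qed.

(** By the inequality of Bernoulli. *)
Lemma scale_unbounded (S : {fset Y}) : 0 < t -> exists n, spread_le (scale n) S.
Proof.
move=> t0; pose D := \big[Num.max/0]_(x <- S) farthest S x.
have D0 : 0 <= D by exact: bigmax_ge_id.
have SD : spread_le D S.
  move=> x y xS yS; apply: le_trans (farthest_ge x yS) _.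
  exact: (@le_bigmax_seq _ _ _ _ _ x xpredT (farthest S)).
have bern n : 1 + n%:R / 10 <= (11 / 10 : R) ^+ n.
  elim: n => [|n IH]; first by rewrite mul0r addr0.
  rewrite exprS -natr1; have := ler0n R n; lra.
have Dt : 0 <= 10 * D / t by rewrite divr_ge0 ?mulr_ge0// ltW.
exists (Num.bound (10 * D / t)); apply: spread_le_trans SD.
have := archi_boundP Dt; set n := Num.bound _; rewrite ltr_pdivrMr// => nD.
have := ler_wpM2r (ltW t0) (bern n); rewrite -/(scale n).
by rewrite mulrDl mul1r mulrAC; lra.
Qed.

End scales.

Theorem theorem3p5 (R : realType) (G : groupType) (X : metricType R)
    (a : isom_action G X) (x0 : X) :
  asymptotically_CAT0 X -> proper_action a -> cocompact a ->
  exists T : R, forall t : R, T <= t ->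
    finite_GCW_complex R (VR_gaction t (orbit_isom_action a x0))
      (@VR_cells R (orbit_space a x0) t) /\
    universal_proper_space R (VR_gaction t (orbit_isom_action a x0))
      (@VR_cells R (orbit_space a x0) t).
Proof.
move=> cat proper cocpt; have [geo _] := cat.
have lfin := orbit_locally_finite geo proper cocpt (x0 := x0).
have [T T0 close] := recenter_close cat lfin (orbit_coarsely_dense cocpt x0).
exists T => t Tt; have t0 : 0 < t by exact: lt_le_trans Tt.
have x0P : x0 \in Defs.orbit a x0 by apply/mem_set; exists 1%g => //; exact: gact1.
have [b _] : exists b : orbit_space a x0, val b = x0.
  by exists (exist (fun x => x \in Defs.orbit a x0) x0 x0P).
apply: (@VR_universal _ _ _ (orbit_isom_action a x0) t (scale t)
  (fun n => recenter (scale t n)) _ _ _ _ _ _ _ b).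
- by rewrite /scale expr0 mul1r.
- by move=> n; rewrite scaleS; have := scale_ge n t0; lra.
- by move=> S; exact: scale_unbounded.
- by move=> n S; exact: recenter_id.
- by move=> n S; exact: recenter_neq0.
- move=> n S S' x y SS' S't; apply: close SS' _; last by rewrite -scaleS.
  exact: le_trans (scale_ge n t0).
- by move=> n g S; exact: recenter_act.
- exact: lfin.
- by move=> x; exact: orbit_transitive.
- by move=> x y; exact: orbit_finite_transporter.
Qed.
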